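(* Let $n\ge2$, let $P\subset\mathbb{R}^n$ be a convex polyhedron with double $D$, singular set $\mathcal{S}\subset D$ and $D_0=D\setminus\mathcal{S}$. Let $\varepsilon>0$, let $U_\varepsilon$ be the $\varepsilon$-neighbourhood of $\mathcal{S}$ in $D$, and let $F:\Omega\times\mathbb{R}\to D_0$ be a maximal periodic tube. Then there exist $\delta>0$, $l>0$ and $\eta>0$ such that for each $(p_0,z_0)\in\big(\Omega_{\varepsilon/2-\eta}\setminus\Omega_{\varepsilon/2+\eta}\big)\times\mathbb{R}$ there exists a point $(p_0,z)$ with $|z-z_0|\le l$ such that the $\delta$-neighbourhood of $(p_0,z)$ is contained in $F^{-1}(U_\varepsilon)$.
   Context: For $r>0$, $\Omega_r\subset\Omega$ denotes the complement in $\Omega$ of the $r$-neighbourhood of $\partial\Omega$. The singular set $\mathcal{S}$ of $P$ is the $(n-2)$-skeleton of $\partial P$. The double is $D=(P\sqcup\sigma P)/\sim$, where $\sigma$ is a reflection of $\mathbb{R}^n$ and $\sim$ identifies pointwise the corresponding faces of $\partial P$ and $\partial(\sigma P)$; the image of the skeleton in $D$ is again denoted $\mathcal{S}$, and $D_0$ is a flat $n$-manifold, whose geodesics correspond to billiard trajectories in $P$. Tubes: for a set $\Omega\subset\mathbb{R}^{n-1}$ (the cross-section) and a local isometry $F:\Omega\times\mathbb{R}\to D_0$, the image $F(\Omega\times\mathbb{R})$ (often identified with $F$) is an immersed tube. It is periodic if there are $L>0$ (its length) and a rotation $\mathcal{R}$ of $\mathbb{R}^n$ fixing the $\mathbb{R}$-direction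 (identified with the induced rotation of $\mathbb{R}^{n-1}$) such that $F(x,t+L)=F(\mathcal{R}x,t)$ for all $(x,t)\in\Omega\times\mathbb{R}$. Maximal tubes: let $\mathcal{F}_1,\dots,\mathcal{F}_l$ be the faces of $P$, let $T\Gamma$ be the set of inward-pointing unit vectors based on $\Gamma=\partial P$, let $T\Gamma_1\subset T\Gamma$ be those whose forward billiard orbit never hits $\mathcal{S}$, and let $f$ be the first return map of the billiard flow to $T\Gamma$. For $x\in T\Gamma_1$ the word $w(x)$ is defined by $w(x)_i=j$ iff the basepoint of $f^i(x)$ lies in $\mathcal{F}_j$, and for a word $w$ that occurs, $X(w)=\{x\in T\Gamma_1:w(x)=w\}$ (a set of parallel vectors). A tube is maximal if it is the tube of parallel trajectories generated by a full set $X(w)$. *)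

(* Defs.v *)
From HB Require Import structures.
From mathcomp Require Import all_boot all_order all_algebra.
From mathcomp Require Import all_classical all_reals all_analysis.
Import Order.TTheory GRing.Theory Num.Theory.
Import numFieldNormedType.Exports.

Set Implicit Arguments.
Unset Strict Implicit.
Unset Printing Implicit Defensive.

Local Open Scope classical_set_scope.
Local Open Scope ring_scope.

(* The library norm on 'rV[R]_n is the sup norm, so the Euclidean structure is
   spelled out. The library topology is used for interiors and boundaries,
   which are the same for both norms. *)
Definition dot (R : realType) (n : nat) (u v : 'rV[R]_n) : R :=
  (u *m v^T) 0 0.

Definition enorm (R : realType) (n : nat) (u : 'rV[R]_n) : R :=
  Num.sqrt (dot u u).

Definition edist (R : realType) (n : nat) (x y : 'rV[R]_n) : R :=
  enorm (x - y).

Definition bdry (T : topologicalType) (A : set T) : set T :=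
  closure A `\` interior A.

Definition Omega_r (R : realType) (m : nat) (Omega : set 'rV[R]_m) (r : R) :
    set 'rV[R]_m :=
  Omega `\` [set x | exists2 y, bdry Omega y & edist x y < r].

Definition convex_polyhedron (R : realType) (n : nat) (P : set 'rV[R]_n) :
    Prop :=
  [/\ exists (k : nat) (a : 'I_k -> 'rV[R]_n) (c : 'I_k -> R),
        P = [set x | forall i, dot (a i) x <= c i],
      exists M : R, forall x, P x -> enorm x <= M
    & interior P !=set0].

Definition dim_le (R : realType) (n : nat) (G : set 'rV[R]_n) (k : nat) :
    Prop :=
  exists2 W : 'M[R]_n, (\rank W <= k)%N &
    forall x y, G x -> G y -> (x - y <= W)%MS.

(* G is the proper (possibly empty) face of P cut out by a supporting
   hyperplane with outward unit normal nu. *)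
Definition face (R : realType) (n : nat) (P : set 'rV[R]_n) (nu : 'rV[R]_n)
    (G : set 'rV[R]_n) : Prop :=
  dot nu nu = 1 /\
  exists2 c : R, (forall x, P x -> dot nu x <= c) &
    G = P `&` [set x | dot nu x = c].

(* The (n-1)-dimensional faces, that is, the faces F_1, ..., F_l. *)
Definition facet (R : realType) (n : nat) (P : set 'rV[R]_n) (nu : 'rV[R]_n)
    (G : set 'rV[R]_n) : Prop :=
  face P nu G /\ ~ dim_le G n.-2.

(* The (n-2)-skeleton of the boundary of P, as a subset of P. *)
Definition skeleton (R : realType) (n : nat) (P : set 'rV[R]_n) :
    set 'rV[R]_n :=
  [set x | exists nu G, [/\ face P nu G, dim_le G n.-2 & G x]].

(* The double. The pair (p, true) stands for p in P and (p, false) for sigma p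
   in sigma P. A point p of the boundary of P is identified with sigma p; the
   class {p, sigma p} is represented by (p, true), so that equality in the
   double is Leibniz equality of representatives. *)
Definition double (R : realType) (n : nat) (P : set 'rV[R]_n) :
    set ('rV[R]_n * bool) :=
  [set x | P x.1 /\ (bdry P x.1 -> x.2 = true)].

(* The metric of the double: the standard metric on the gluing of two metric
   spaces along isometric closed subsets. P being convex, its Euclidean metric
   is its path metric, hence this is the path metric of the double. *)
Definition ddist (R : realType) (n : nat) (P : set 'rV[R]_n)
    (x y : 'rV[R]_n * bool) : R :=
  if x.2 == y.2 then edist x.1 y.1
  else inf [set edist x.1 b + edist b y.1 | b in bdry P].

Definition dsing (R : realType) (n : nat) (P : set 'rV[R]_n) :
    set ('rV[R]_n * bool) :=
  [set x | skeleton P x.1 /\ x.2 = true].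

Definition double0 (R : realType) (n : nat) (P : set 'rV[R]_n) :
    set ('rV[R]_n * bool) :=
  double P `\` dsing P.

Definition U_ (R : realType) (n : nat) (P : set 'rV[R]_n) (eps : R) :
    set ('rV[R]_n * bool) :=
  [set x | double P x /\ exists2 s, dsing P s & ddist P x s < eps].

(* A phase is a pair (basepoint, direction). *)
Definition inward (R : realType) (n : nat) (P : set 'rV[R]_n) :
    set ('rV[R]_n * 'rV[R]_n) :=
  [set x | [/\ bdry P x.1, enorm x.2 = 1 &
    \forall s \near 0^'+, interior P (x.1 + s *: x.2)]].

(* The graph of the first return map of the billiard flow: fly through the
   interior of P until its boundary is reached, then reflect in the face. At a
   landing point off the skeleton the face, hence the image, is unique. *)
Definition return_map (R : realType) (n : nat) (P : set 'rV[R]_n)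
    (x y : 'rV[R]_n * 'rV[R]_n) : Prop :=
  exists2 tau : R, 0 < tau &
    [/\ y.1 = x.1 + tau *: x.2,
        forall s, 0 < s < tau -> interior P (x.1 + s *: x.2)
      & exists nu G, [/\ facet P nu G, G y.1 &
          y.2 = x.2 - (2 * dot x.2 nu) *: nu]].

(* The vectors of TGamma_1 with itinerary w. The letters of a word are the
   (n-1)-dimensional faces themselves instead of their indices. *)
Definition X_ (R : realType) (n : nat) (P : set 'rV[R]_n)
    (w : nat -> set 'rV[R]_n) : set ('rV[R]_n * 'rV[R]_n) :=
  [set x | inward P x /\
    exists u : nat -> 'rV[R]_n * 'rV[R]_n,
      [/\ u 0%N = x,
          forall i, return_map P (u i) (u i.+1),
          forall i, ~ skeleton P (u i).1
        & forall i, (exists nu, facet P nu (w i)) /\ w i (u i).1]].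

Definition tdist (R : realType) (m : nat) (x y : 'rV[R]_m * R) : R :=
  Num.sqrt (edist x.1 y.1 ^+ 2 + (x.2 - y.2) ^+ 2).

Definition immersed_tube (R : realType) (n : nat) (P : set 'rV[R]_n)
    (Omega : set 'rV[R]_n.-1) (F : 'rV[R]_n.-1 * R -> 'rV[R]_n * bool) :
    Prop :=
  forall x, (Omega `*` setT) x ->
    double0 P (F x) /\
    exists2 r : R, 0 < r &
      forall y z, (Omega `*` setT) y -> (Omega `*` setT) z ->
        tdist x y < r -> tdist x z < r -> ddist P (F y) (F z) = tdist y z.

Definition periodic_tube (R : realType) (n : nat)
    (Omega : set 'rV[R]_n.-1) (F : 'rV[R]_n.-1 * R -> 'rV[R]_n * bool) :
    Prop :=
  exists2 L : R, 0 < L &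
    exists2 Rot : 'M[R]_n.-1, Rot *m Rot^T = 1%:M /\ \det Rot = 1 &
      forall x t, Omega x ->
        Omega (x *m Rot) /\ F (x, t + L) = F (x *m Rot, t).

(* The tube generated by X(w). The cross-section hyperplane is placed in R^n
   by the isometry x |-> a + x *m E, orthogonally to the common direction v of
   the vectors of X(w), and C is the set of those x for which the line through
   a + x *m E directed by v carries a vector of X(w). The side of the double
   from which the trajectories start is b.
   X(w) constrains forward orbits only. If Rot has infinite order, some vectors
   of X(w), all over the boundary of C, may have a backward orbit that meets
   the skeleton, so that they belong to no tube Omega * R -> D_0; therefore
   Omega and C are required to coincide only up to boundary points. *)
Definition maximal_tube (R : realType) (n : nat) (P : set 'rV[R]_n)
    (Omega : set 'rV[R]_n.-1) (F : 'rV[R]_n.-1 * R -> 'rV[R]_n * bool) :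
    Prop :=
  exists (w : nat -> set 'rV[R]_n) (a v : 'rV[R]_n) (E : 'M[R]_(n.-1, n))
      (b : bool),
    let line x t := a + x *m E + t *: v in
    let C := [set x | exists t : R, X_ P w (line x t, v)] in
    [/\ X_ P w !=set0 /\ (forall y, X_ P w y -> y.2 = v),
        [/\ E *m E^T = 1%:M, E *m v^T = 0 & dot v v = 1],
        interior C `<=` Omega /\ Omega `<=` C
      & forall x t, Omega x -> X_ P w (line x t, v) ->
          forall s : R, 0 < s ->
          (forall r, 0 < r <= s -> interior P (line x (t + r))) ->
          F (x, t + s) = (line x (t + s), b)].

(* Main.v *)
Require Import Defs.
From mathcomp Require Import all_boot all_order all_algebra.
From mathcomp Require Import ring lra.
From mathcomp Require Import all_classical all_reals all_analysis.
Import Order.TTheory GRing.Theory Num.Theory.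
Import numFieldNormedType.Exports.
(* The second import makes [edist] denote the Euclidean distance again. *)
Import Defs.
Local Open Scope classical_set_scope.
Local Open Scope ring_scope.

Set Implicit Arguments.
Unset Strict Implicit.
Unset Printing Implicit Defensive.

(** The reason for the theorem is that a maximal tube can stop at a boundary
    point [q] of its cross-section only because trajectories next to [q] come
    arbitrarily close to the skeleton. A point [p0] at distance about [eps / 2]
    from the boundary has such a [q] at distance less than [eps / 2 + eta], and
    parallel trajectories stay at constant distance in the unfolded picture, so
    that the trajectory of [p0] and those near it enter the [eps]-neighbourhood
    of the skeleton.

    The word [w] of the tube determines a sequence of affine reflections, hence
    isometries [fold i] that send the line through a point [z] directed by [v] to
    the line carrying the [i]-th flight of the billiard trajectory that starts
    along it. The time [hit i z] at which the [i]-th facet is met, and the landing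
    point [land i z], are affine in [z], and a vector on the line has word [w] if
    and only if all the landing points are in the polyhedron, off the skeleton
    ([X_good], [good_X]). Two facts are drawn from this picture. Of all the lines
    [fold i], the trajectory follows at each time one that is closest to any given
    point of the polyhedron ([billiard_closest]), because unfolding reflects away
    from the polyhedron. And if the trajectory of [z] avoids a neighbourhood of
    the skeleton, then all the parallel lines near [z] have the same word
    ([good_ball]).

    The map [F] is only known to be a local isometry whose first flights are
    prescribed. Since the double is flat off the skeleton, with charts given by
    [unfold], its restriction to each line is a geodesic that is straight inside
    the polyhedron and passes to the other copy, reflected, when it meets a facet
    ([geodesic_cross]), and that meets facets only finitely often in bounded time
    ([geodesic_nonzeno]). Hence it is the billiard trajectory
    ([trajectory_cover]).

    It remains to make the time at which the skeleton is approached uniform.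
    The rotation of the periodic tube is an isometry of a bounded set into itself,
    so that its orbits are recurrent ([recurrence]). This allows one to require
    that the skeleton be approached late ([bdry_near_skeleton]) and to move by
    negative multiples of the period ([ball_sub_pullback]). Compactness of the
    boundary bounds the time by some [l] ([bdry_near_skeleton_uniform]), and
    periodicity moves it to the vicinity of any [z0] ([tube_near_skeleton]). *)

(** * Euclidean geometry of row vectors *)

Section Euclid.
Context {R : realType} {n : nat}.
Implicit Types (u v w x y z : 'rV[R]_n) (a : R).

Lemma dotE u v : dot u v = \sum_i u 0 i * v 0 i.
Proof. by rewrite /dot mxE; apply: eq_bigr => i _; rewrite mxE. Qed.

Lemma dotC u v : dot u v = dot v u.
Proof. by rewrite !dotE; apply: eq_bigr => i _; rewrite mulrC. Qed.

Lemma dotDl u v w : dot (u + v) w = dot u w + dot v w.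
Proof. by rewrite /dot mulmxDl mxE. Qed.

Lemma dotZl a u v : dot (a *: u) v = a * dot u v.
Proof. by rewrite /dot -scalemxAl mxE. Qed.

Lemma dotNl u v : dot (- u) v = - dot u v.
Proof. by rewrite -scaleN1r dotZl mulN1r. Qed.

Lemma dotBl u v w : dot (u - v) w = dot u w - dot v w.
Proof. by rewrite dotDl dotNl. Qed.

Lemma dotDr u v w : dot u (v + w) = dot u v + dot u w.
Proof. by rewrite dotC dotDl !(dotC _ u). Qed.

Lemma dotZr a u v : dot u (a *: v) = a * dot u v.
Proof. by rewrite dotC dotZl dotC. Qed.

Lemma dotNr u v : dot u (- v) = - dot u v.
Proof. by rewrite dotC dotNl dotC. Qed.

Lemma dotBr u v w : dot u (v - w) = dot u v - dot u w.
Proof. by rewrite dotDr dotNr. Qed.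

Definition dotlin := (dotDl, dotBl, dotZl, dotNl, dotDr, dotBr, dotZr, dotNr).

Lemma dot_ge0 u : 0 <= dot u u.
Proof. by rewrite dotE sumr_ge0 // => i _; rewrite -expr2 sqr_ge0. Qed.

Lemma dot_eq0 u : dot u u = 0 -> u = 0.
Proof.
rewrite dotE => /psumr_eq0P h; apply/rowP => i; rewrite mxE.
have /eqP := h (fun i _ => ltac:(by rewrite -expr2 sqr_ge0)) i isT.
by rewrite mulf_eq0 orbb => /eqP.
Qed.

Lemma enorm_ge0 u : 0 <= enorm u.
Proof. exact: sqrtr_ge0. Qed.

Lemma enorm_sqr u : enorm u ^+ 2 = dot u u.
Proof. by rewrite sqr_sqrtr ?dot_ge0. Qed.

Lemma enorm1 u : dot u u = 1 -> enorm u = 1.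
Proof. by rewrite /enorm => ->; rewrite sqrtr1. Qed.

Lemma enormZ a u : enorm (a *: u) = `|a| * enorm u.
Proof.
by rewrite /enorm !dotlin mulrA -expr2 sqrtrM ?sqr_ge0 // sqrtr_sqr.
Qed.

Lemma enormN u : enorm (- u) = enorm u.
Proof. by rewrite -scaleN1r enormZ normrN1 mul1r. Qed.

Lemma dot_le_enorm u v : dot u v <= enorm u * enorm v.
Proof.
have hu := enorm_ge0 u; have hv := enorm_ge0 v.
(* The inequality is contained in |v| u - |u| v having a squared norm >= 0. *)
have := dot_ge0 (enorm v *: u - enorm u *: v).
rewrite !dotlin -!enorm_sqr (dotC v u) => h.
have [u0|u0] := eqVneq (enorm u) 0.
  have : u = 0 by apply: dot_eq0; rewrite -enorm_sqr u0 expr0n.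
  by move=> ->; rewrite -{1}(scale0r (0 : 'rV_n)) dotZl mul0r mulr_ge0 ?enorm_ge0.
have [v0|v0] := eqVneq (enorm v) 0.
  have : v = 0 by apply: dot_eq0; rewrite -enorm_sqr v0 expr0n.
  by move=> ->; rewrite -{1}(scale0r (0 : 'rV_n)) dotZr mul0r mulr_ge0 ?enorm_ge0.
have up : 0 < enorm u by rewrite lt0r u0.
have vp : 0 < enorm v by rewrite lt0r v0.
have uv : 0 < enorm u * enorm v by apply: mulr_gt0.
rewrite -(ler_pM2l uv).
move: h; set p := enorm u; set q := enorm v; set d := dot u v => h.
lra.
Qed.

Lemma enorm_le u v : dot u u <= dot v v -> enorm u <= enorm v.
Proof. by move=> h; rewrite /enorm ler_wsqrtr. Qed.

Lemma enormD u v : enorm (u + v) <= enorm u + enorm v.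
Proof.
have h : 0 <= enorm u + enorm v by rewrite addr_ge0 ?enorm_ge0.
rewrite -(@ler_pXn2r _ 2) ?nnegrE ?enorm_ge0 //.
rewrite enorm_sqr !dotlin -!enorm_sqr (dotC v u).
by have := dot_le_enorm u v; lra.
Qed.

Lemma edist_ge0 x y : 0 <= edist x y.
Proof. exact: enorm_ge0. Qed.

Lemma edistxx x : edist x x = 0.
Proof. by rewrite /edist subrr -(scale0r (0 : 'rV_n)) enormZ normr0 mul0r. Qed.

Lemma edistC x y : edist x y = edist y x.
Proof. by rewrite /edist -opprB enormN. Qed.

Lemma edist_triangle y x z : edist x z <= edist x y + edist y z.
Proof.
have -> : edist x z = enorm (x - y + (y - z)) by rewrite addrA subrK.
exact: enormD.
Qed.

Lemma edist_eq0 x y : edist x y = 0 -> x = y.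
Proof.
move=> h; apply/eqP; rewrite -subr_eq0; apply/eqP/dot_eq0.
by rewrite -enorm_sqr -/(edist x y) h expr0n.
Qed.

Lemma edist_addl x y z : edist (x + y) (x + z) = edist y z.
Proof. by rewrite /edist opprD addrACA subrr add0r. Qed.

Lemma edist_addr x y z : edist (y + x) (z + x) = edist y z.
Proof. by rewrite ![_ + x]addrC edist_addl. Qed.

Lemma edist_line x u s t : edist (x + s *: u) (x + t *: u) = `|s - t| * enorm u.
Proof. by rewrite edist_addl /edist -scalerBl enormZ. Qed.

Lemma edist_shift x u s : edist x (x + s *: u) = `|s| * enorm u.
Proof. by rewrite /edist opprD addrA subrr add0r enormN enormZ. Qed.

Lemma coord_le_enorm u i : `|u 0 i| <= enorm u.
Proof.
rewrite -sqrtr_sqr /enorm ler_wsqrtr // dotE (bigD1 i) //= expr2.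
by rewrite lerDl sumr_ge0 // => j _; rewrite -expr2 sqr_ge0.
Qed.

Lemma norm_le_enorm u : `|u| <= enorm u.
Proof.
rewrite [leLHS]/Num.norm /= mx_normrE; apply/bigmax_leP; split.
  exact: enorm_ge0.
by case=> i j _ /=; rewrite (ord1 i); apply: coord_le_enorm.
Qed.

Lemma enorm_le_coord u (e : R) : 0 < e ->
  (forall i, `|u 0 i| < e / n.+1%:R) -> enorm u < e.
Proof.
move=> e0 h; rewrite -(@ltr_pXn2r _ 2) ?nnegrE ?enorm_ge0 ?ltW //.
have n0 : 0 < n.+1%:R :> R by rewrite ltr0n.
rewrite enorm_sqr dotE.
apply: (@le_lt_trans _ _ (\sum_(i < n) (e / n.+1%:R) ^+ 2)).
  apply: ler_sum => i _; rewrite -expr2 -real_normK ?num_real //.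
  by rewrite ler_pXn2r ?nnegrE ?normr_ge0 ?divr_ge0 ?ltW.
rewrite sumr_const card_ord -[ltLHS]mulr_natr expr_div_n.
rewrite -mulrA gtr_pMr ?exprn_gt0 // mulrC ltr_pdivrMr ?exprn_gt0 // mul1r.
rewrite -natrX ltr_nat expnS expn1; exact: leq_pmulr.
Qed.

Lemma nbhs_edistP x (A : set 'rV[R]_n) :
  nbhs x A <-> exists2 r : R, 0 < r & forall y, edist x y < r -> A y.
Proof.
split.
  move=> /nbhs_ballP[e /= e0 he]; exists e => // y xy; apply: he.
  split=> // i j; rewrite (ord1 i) -ball_normE /=.
  apply: le_lt_trans xy; have := coord_le_enorm (x - y) j.
  by rewrite !mxE.
move=> [r r0 h]; apply/nbhs_ballP; exists (r / n.+1%:R) => /=.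
  by rewrite divr_gt0.
move=> y [_ hy]; apply: h; apply: enorm_le_coord => // i.
by have := hy 0 i; rewrite -ball_normE /= !mxE.
Qed.

Lemma interiorP (A : set 'rV[R]_n) x :
  interior A x <-> exists2 r : R, 0 < r & forall y, edist x y < r -> A y.
Proof. exact: nbhs_edistP. Qed.

Lemma closureP (A : set 'rV[R]_n) x :
  closure A x <-> forall e : R, 0 < e -> exists2 y, A y & edist x y < e.
Proof.
split=> [h e e0|h B /nbhs_edistP[r r0 hr]].
  have /h[y [Ay hy]] : nbhs x [set y | edist x y < e].
    by apply/nbhs_edistP; exists e.
  by exists y.
by have [y Ay xy] := h r r0; exists y; split => //; apply: hr.
Qed.

Lemma interior_edist (A : set 'rV[R]_n) x r :
  (forall y, edist x y < r -> A y) -> forall y, edist x y < r -> interior A y.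
Proof.
move=> h y xy; apply/interiorP; exists (r - edist x y); first by rewrite subr_gt0.
move=> z yz; apply: h; apply: le_lt_trans (edist_triangle y x z) _.
by rewrite -ltrBrDl.
Qed.

(** The boundary point is at the supremum of the parameters whose points on the
    segment belong to the set. *)
Lemma segment_bdry (A : set 'rV[R]_n) x y : A x -> ~ A y ->
  exists2 s : R, 0 <= s <= 1 & bdry A (x + s *: (y - x)).
Proof.
move=> Ax nAy.
pose B := [set s : R | 0 <= s <= 1 /\ A (x + s *: (y - x))].
have B0 : B 0 by split; rewrite ?lexx ?ler01 // scale0r addr0.
have ubB : has_ubound B by exists 1 => s [/andP[]].
have s0 : 0 <= sup B by apply: ub_le_sup.
have s1 : sup B <= 1 by apply: ge_sup; [exists 0 | move=> s [/andP[]]].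
exists (sup B); first by rewrite s0 s1.
have dxy : 0 <= enorm (y - x) by apply: enorm_ge0.
split.
  apply/closureP => e e0.
  have d0 : 0 < e / (enorm (y - x) + 1) by rewrite divr_gt0 ?ltr_wpDl.
  have [//|s Bs hs] := @sup_adherent _ B _ d0; first by split; [exists 0|].
  exists (x + s *: (y - x)); first by case: Bs.
  rewrite edist_line ger0_norm ?subr_ge0 ?ub_le_sup //.
  apply: (@le_lt_trans _ _ (e / (enorm (y - x) + 1) * enorm (y - x))).
    by rewrite ler_wpM2r // lerBlDl -lerBlDr ltW.
  rewrite -mulrA gtr_pMr // mulrC ltr_pdivrMr ?ltr_wpDl // mul1r.
  by rewrite ltrDl.
move=> /interiorP[r r0 hr].
have [s1'|s1'] := eqVneq (sup B) 1.
  have : A (x + sup B *: (y - x)) by apply: hr; rewrite edistxx.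
  by rewrite s1' scale1r addrC subrK.
have {s1 s1'} s1 : sup B < 1 by rewrite lt_neqAle s1' s1.
pose d := Num.min (1 - sup B) (r / (enorm (y - x) + 1) / 2).
have q0 : 0 < r / (enorm (y - x) + 1) by rewrite divr_gt0 ?ltr_wpDl.
have d0 : 0 < d by rewrite lt_min subr_gt0 s1 divr_gt0.
have : B (sup B + d).
  split.
    rewrite addr_ge0 ?(ltW d0) //=.
    by rewrite -lerBrDl ge_min lexx.
  apply: hr; rewrite edist_line opprD addrA subrr add0r normrN gtr0_norm //.
  apply: (@le_lt_trans _ _ (r / (enorm (y - x) + 1) / 2 * enorm (y - x))).
    by rewrite ler_wpM2r // ge_min lexx orbT.
  have : r / (enorm (y - x) + 1) * (enorm (y - x) + 1) = r.
    by rewrite divfK // gt_eqF ?ltr_wpDl.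
  have := mulr_ge0 (ltW q0) dxy.
  move: q0; set q := r / _; set d' := enorm _ => q0; nra.
by move=> /(ub_le_sup ubB); rewrite leNgt ltrDl d0.
Qed.

End Euclid.

(** * Faces of a convex polyhedron *)

Definition supporting {R : realType} {n : nat} (P : set 'rV[R]_n)
    (nu : 'rV[R]_n) (c : R) : Prop :=
  dot nu nu = 1 /\ forall x, P x -> dot nu x <= c.

Section Polyhedron.
Context {R : realType} {n : nat} (P : set 'rV[R]_n).
Hypothesis hP : convex_polyhedron P.
Implicit Types (x y z nu : 'rV[R]_n) (c : R).

Lemma unit_gap nu x y : dot nu nu = 1 -> dot nu y <= dot nu x + edist x y.
Proof.
move=> nu1; rewrite -lerBlDl -dotBr edistC.
by apply: le_trans (dot_le_enorm _ _) _; rewrite enorm1 // mul1r.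
Qed.

Lemma polyhedron_segment x y s : P x -> P y -> 0 <= s <= 1 ->
  P (x + s *: (y - x)).
Proof.
case: hP => -[k [a [c PE]]] _ _; rewrite PE /= => hx hy /andP[s0 s1] i.
have := hx i; have := hy i; rewrite !dotlin.
by move: (dot _ x) (dot _ y) => p q; nra.
Qed.

Lemma polyhedron_closed x : closure P x -> P x.
Proof.
case: hP => -[k [a [c PE]]] _ _; rewrite PE => /closureP hx /= i.
rewrite leNgt; apply/negP => h.
have a0 : 0 < enorm (a i) + 1 by rewrite ltr_wpDl ?enorm_ge0.
have d0 : 0 < (dot (a i) x - c i) / (enorm (a i) + 1).
  by rewrite divr_gt0 ?subr_gt0.
have [y /(_ i) hy xy] := hx _ d0.
have := dot_le_enorm (a i) (x - y); rewrite -/(edist x y) dotBr.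
have := enorm_ge0 (a i); have := edist_ge0 x y.
move: xy; rewrite ltr_pdivlMr // mulrDr mulr1.
by move: (dot _ _) (dot _ _) (edist _ _) (enorm _) h hy => p q d e; nra.
Qed.

Lemma polyhedron_bdryP x : bdry P x <-> P x /\ ~ interior P x.
Proof.
split=> [[/polyhedron_closed]|[Px nx]] //; split=> //.
by apply/closureP => e e0; exists x; rewrite ?edistxx.
Qed.

Lemma interior_segment x y s : P x -> interior P y -> 0 < s <= 1 ->
  interior P (x + s *: (y - x)).
Proof.
move=> Px /interiorP[r r0 hr] /andP[s0 s1]; apply/interiorP.
exists (s * r) => [|z hz]; first by rewrite mulr_gt0.
pose y' := y + s^-1 *: (z - (x + s *: (y - x))).
have -> : z = x + s *: (y' - x).
  have -> : y' - x = y - x + s^-1 *: (z - (x + s *: (y - x))).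
    by rewrite /y' addrAC.
  by rewrite scalerDr scalerA divff ?gt_eqF // scale1r addrA addrC subrK.
apply: polyhedron_segment; rewrite ?(ltW s0) //; apply: hr.
by rewrite /y' edist_shift gtr0_norm ?invr_gt0 // mulrC ltr_pdivrMr // -/(edist _ _) edistC mulrC.
Qed.

Lemma interior_lt_support nu c x : supporting P nu c -> interior P x ->
  dot nu x < c.
Proof.
move=> [nu1 hnu] /interiorP[r r0 hr].
have : P (x + (r / 2) *: nu).
  apply: hr; rewrite edist_shift enorm1 // mulr1 ger0_norm; lra.
by move=> /hnu; rewrite !dotlin nu1; lra.
Qed.

Lemma support_not_interior nu c x : supporting P nu c -> dot nu x = c ->
  ~ interior P x.
Proof. by move=> /interior_lt_support h e /h; rewrite e ltxx. Qed.

Lemma support_bdry nu c x : supporting P nu c -> P x -> dot nu x = c ->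
  bdry P x.
Proof. by move=> h Px /(support_not_interior h); rewrite polyhedron_bdryP. Qed.

Lemma skeleton_bdry x : skeleton P x -> bdry P x.
Proof.
move=> [nu [G [[nu1 [c hc ->]] _ [Px xc]]]].
exact: (@support_bdry nu c).
Qed.

(** The normalised sum of the two normals supports [P] exactly along the
    intersection of the two faces, whose codimension is at least two because the
    normals are independent. They are not opposite since [P] has an interior
    point. *)
Lemma two_supports_skeleton nu1 nu2 c1 c2 y :
  supporting P nu1 c1 -> supporting P nu2 c2 -> nu1 <> nu2 ->
  P y -> dot nu1 y = c1 -> dot nu2 y = c2 -> skeleton P y.
Proof.
move=> h1 h2 neq Py y1 y2.
have [z hz] : interior P !=set0 by case: hP.
have z1 := interior_lt_support h1 hz; have z2 := interior_lt_support h2 hz.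
have [[u1 H1] [u2 H2]] := (h1, h2).
have nopp : nu1 + nu2 <> 0.
  move=> /eqP; rewrite addr_eq0 => /eqP e; move: y1 z1; rewrite e !dotlin.
  by lra.
pose m := enorm (nu1 + nu2).
have m0 : 0 < m.
  rewrite lt0r enorm_ge0 andbT; apply/eqP => e; apply/nopp/dot_eq0.
  by rewrite -enorm_sqr -/m e expr0n.
exists (m^-1 *: (nu1 + nu2)), (P `&` [set x | dot (m^-1 *: (nu1 + nu2)) x = (c1 + c2) / m]).
split.
- split.
    by rewrite dotZl dotZr -enorm_sqr -/m; field; rewrite gt_eqF.
  exists ((c1 + c2) / m) => // x Px.
  by rewrite dotZl mulrC ler_pM2r ?invr_gt0 // dotDl lerD ?H1 ?H2.
- exists (kermx (col_mx nu1 nu2)^T).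
    rewrite mxrank_ker mxrank_tr -subn2 leq_sub2l //.
    rewrite -addsmxE.
    have r1 : \rank nu1 = 1%N.
      rewrite rank_rV; case: eqP => // e; move: u1.
      by rewrite e -(scale0r (0 : 'rV_n)) dotZl mul0r => /esym/eqP; rewrite oner_eq0.
    have : (nu1 < nu1 + nu2)%MS.
      rewrite /ltmx addsmxSl /=; apply/negP => h.
      have /sub_rVP[a e] := submx_trans (addsmxSr nu1 nu2) h.
      move: u2; rewrite e dotZl dotZr u1 mulr1 => /eqP.
      rewrite -expr2 sqrf_eq1 => /orP[] /eqP a1.
        by apply: neq; rewrite e a1 scale1r.
      by apply: nopp; rewrite e a1 scaleN1r subrr.
    by rewrite ltmxErank r1 => /andP[].
  move=> x x' [Px /= hx] [Px' /= hx'].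
  have key u : P u -> dot (m^-1 *: (nu1 + nu2)) u = (c1 + c2) / m ->
      dot nu1 u = c1 /\ dot nu2 u = c2.
    move=> Pu; rewrite dotZl mulrC => /(mulIf _); rewrite invr_eq0 gt_eqF //.
    rewrite dotDl => /(_ isT); have := H1 _ Pu; have := H2 _ Pu; lra.
  have [e1 e2] := key _ Px hx; have [e1' e2'] := key _ Px' hx'.
  apply/sub_kermxP; rewrite tr_col_mx mul_mx_row.
  have z0 nu : dot nu (x - x') = 0 -> (x - x') *m nu^T = 0.
    move=> d0; apply/matrixP => i j; rewrite !ord1.
    by rewrite -[LHS]/(dot (x - x') nu) dotC d0 mxE.
  by rewrite !z0 ?row_mx0 // dotBr ?e1 ?e1' ?e2 ?e2' subrr.
- by split=> //=; rewrite dotZl dotDl y1 y2 mulrC.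
Qed.

(** All the active constraints at [y] are multiples of a single one, since two
    different active hyperplanes would put [y] on the skeleton; the inactive ones
    remain strict nearby. *)
Lemma locally_half_space y : P y -> ~ skeleton P y -> ~ interior P y ->
  exists nu c, [/\ supporting P nu c, dot nu y = c &
    exists2 r : R, 0 < r & forall x, edist y x < r -> P x <-> dot nu x <= c].
Proof.
move=> Py nsk nint; case: (hP) => -[k [a [c PE]]] _ _.
have near_inactive : exists2 r : R, 0 < r &
    forall x i, edist y x < r -> dot (a i) y < c i -> dot (a i) x < c i.
  pose g i := if dot (a i) y < c i
              then (c i - dot (a i) y) / (enorm (a i) + 1) else 1.
  have a0 i : 0 < enorm (a i) + 1 by rewrite ltr_wpDl ?enorm_ge0.
  have g0 i : 0 < g i.
    by rewrite /g; case: ifPn => // h; rewrite divr_gt0 ?subr_gt0.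
  exists (\big[Num.min/1]_i g i); first exact/lt_bigmin.
  move=> x i hx hi; have : edist y x < g i.
    by apply: lt_le_trans hx _; apply: bigmin_le_cond.
  rewrite /g hi ltr_pdivlMr // mulrDr mulr1 edistC => h.
  have := dot_le_enorm (a i) (x - y); rewrite -/(edist x y) dotBr.
  by have := edist_ge0 x y; move: h; rewrite (mulrC (edist _ _)); lra.
have [r r0 hr] := near_inactive.
have active i : ~~ (dot (a i) y < c i) -> a i <> 0 ->
    supporting P ((enorm (a i))^-1 *: a i) (c i / enorm (a i)) /\
    dot ((enorm (a i))^-1 *: a i) y = c i / enorm (a i).
  rewrite -leNgt => hi ai; have yi : dot (a i) y = c i.
    by apply/eqP; rewrite eq_le hi andbT; move: Py; rewrite PE; apply.
  have e0 : enorm (a i) != 0.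
    by apply/eqP => e; apply/ai/dot_eq0; rewrite -enorm_sqr e expr0n.
  split; last by rewrite dotZl yi mulrC.
  split.
    by rewrite dotZl dotZr -enorm_sqr; field.
  move=> x; rewrite PE => /(_ i) h; rewrite dotZl mulrC.
  by rewrite ler_wpM2r ?invr_ge0 ?enorm_ge0.
have [i [hi ai]] : exists i, ~~ (dot (a i) y < c i) /\ a i <> 0.
  apply: contrapT => none; apply: nint; apply/interiorP; exists r => // x yx.
  rewrite PE => i; have [hi|hi] := boolP (dot (a i) y < c i).
    by apply/ltW/hr.
  have ai : a i = 0 by apply: contrapT => ai; apply: none; exists i.
  have := Py; rewrite PE => /(_ i).
  by rewrite ai -(scale0r (0 : 'rV_n)) !dotZl !mul0r.
have [si yi] := active _ hi ai.
exists ((enorm (a i))^-1 *: a i), (c i / enorm (a i)); split=> //.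
exists r => // x yx; split; first by case: si => _; apply.
move=> xi; rewrite PE => j; have [hj|hj] := boolP (dot (a j) y < c j).
  by apply/ltW/hr.
have [aj|/eqP aj] := eqVneq (a j) 0.
  have := Py; rewrite PE => /(_ j).
  by rewrite aj -(scale0r (0 : 'rV_n)) !dotZl !mul0r.
have [sj yj] := active _ hj aj.
have e : (enorm (a i))^-1 *: a i = (enorm (a j))^-1 *: a j.
  by apply: contrapT => ne; apply: nsk; apply: (two_supports_skeleton si sj).
have ej : enorm (a j) != 0.
  by apply/eqP => e'; apply/aj/dot_eq0; rewrite -enorm_sqr e' expr0n.
have ec : c i / enorm (a i) = c j / enorm (a j) by rewrite -yi -yj e.
move: xi; rewrite e ec dotZl mulrC ler_pM2r // invr_gt0.
by rewrite lt0r ej enorm_ge0.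
Qed.

Lemma facet_half_space nu c y : supporting P nu c -> dot nu y = c ->
  P y -> ~ skeleton P y ->
  exists2 r : R, 0 < r & forall x, edist y x < r ->
    (P x <-> dot nu x <= c) /\ (interior P x <-> dot nu x < c).
Proof.
move=> s yc Py nsk.
have [nu' [c' [s' yc' [r r0 hr]]]] :=
  locally_half_space Py nsk (support_not_interior s yc).
have e : nu = nu'.
  by apply: contrapT => ne; apply: nsk; apply: (two_supports_skeleton s s').
move: yc' hr; rewrite -e yc => <- hr.
exists r => // x yx; split; first exact: hr.
split; first exact: interior_lt_support.
move=> xc; apply/interiorP; exists (Num.min (r - edist y x) (c - dot nu x)).
  by rewrite lt_min !subr_gt0 yx xc.
move=> z; rewrite lt_min => /andP[z1 z2]; apply/hr.
  by apply: le_lt_trans (edist_triangle x _ _) _; rewrite -ltrBrDl.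
by have := unit_gap x z s.1; lra.
Qed.

(** Around a point of the facet off the skeleton, the polyhedron contains a
    neighbourhood of this point in the hyperplane, so that a segment in the
    hyperplane cannot leave the polyhedron there. *)
Lemma facet_exit_skeleton nu c x y : supporting P nu c ->
  dot nu x = c -> dot nu y = c -> P x -> ~ (P y /\ ~ skeleton P y) ->
  exists2 s : R, 0 <= s <= 1 & skeleton P (x + s *: (y - x)).
Proof.
move=> [nu1 hnu] xc yc Px ny.
have [Py|nPy] := pselect (P y).
  exists 1; rewrite ?lexx ?ler01 // scale1r addrC subrK.
  by apply: contrapT => h; apply: ny.
(* Cylinder over the facet, so that leaving it means leaving the facet. *)
pose proj z := z - (dot nu z - c) *: nu.
have projE z : dot nu z = c -> proj z = z.
  by move=> zc; rewrite /proj zc subrr scale0r subr0.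
have [s s01 [cls nint]] : exists2 s : R, 0 <= s <= 1 &
    bdry [set z | P (proj z)] (x + s *: (y - x)).
  by apply: segment_bdry; rewrite /= projE.
exists s => //; move: cls nint; set z := x + _.
have zc : dot nu z = c by rewrite /z !dotlin xc yc subrr mulr0 addr0.
clearbody z.
have proj_le u : edist z (proj u) <= edist z u.
  apply: enorm_le; have -> : z - proj u = z - u + (dot nu u - c) *: nu.
    by rewrite /proj opprB addrA addrAC.
  rewrite !dotlin nu1 zc.
  rewrite (dotC z nu) (dotC u nu) zc.
  by have := sqr_ge0 (dot nu u - c); lra.
move=> /closureP clz nint; apply: contrapT => nsk.
have Pz : P z.
  apply: polyhedron_closed; apply/closureP => e /clz[u /= Pu zu].
  by exists (proj u) => //; apply: le_lt_trans (proj_le u) zu.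
have [r r0 hr] := facet_half_space (conj nu1 hnu) zc Pz nsk.
apply: nint; apply/interiorP; exists r => // u zu /=.
apply/(hr _ (le_lt_trans (proj_le u) zu)).1.
by rewrite /proj !dotlin nu1; lra.
Qed.

End Polyhedron.

(** * Reflections *)

Definition refl {R : realType} {n : nat} (nu : 'rV[R]_n) (c : R)
  (z : 'rV[R]_n) : 'rV[R]_n := z - (2 * (dot nu z - c)) *: nu.

Definition reflv {R : realType} {n : nat} (nu v : 'rV[R]_n) : 'rV[R]_n :=
  v - (2 * dot v nu) *: nu.

Section Reflection.
Context {R : realType} {n : nat} (nu : 'rV[R]_n) (c : R).
Hypothesis nu1 : dot nu nu = 1.
Implicit Types (x y z v : 'rV[R]_n).

Lemma dot_refl z : dot nu (refl nu c z) = 2 * c - dot nu z.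
Proof. by rewrite /refl !dotlin nu1; lra. Qed.

Lemma reflK : involutive (refl nu c).
Proof.
by move=> z; apply/rowP => i; rewrite /refl !mxE !dotlin nu1; ring.
Qed.

Lemma refl_fix z : dot nu z = c -> refl nu c z = z.
Proof. by move=> zc; rewrite /refl zc subrr mulr0 scale0r subr0. Qed.

Lemma refl_line z v s :
  refl nu c (z + s *: v) = refl nu c z + s *: reflv nu v.
Proof.
apply/rowP => i; rewrite /refl /reflv !mxE !dotlin (dotC v nu); lra.
Qed.

Lemma refl_sub x y : refl nu c x - refl nu c y = reflv nu (x - y).
Proof. by apply/rowP => i; rewrite /refl /reflv !mxE !dotlin !(dotC _ nu); lra. Qed.

Lemma dot_reflv v : dot (reflv nu v) (reflv nu v) = dot v v.
Proof. by rewrite /reflv !dotlin nu1 (dotC nu v); lra. Qed.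

Lemma dot_reflv_nu v : dot nu (reflv nu v) = - dot nu v.
Proof. by rewrite /reflv !dotlin nu1 (dotC v nu); lra. Qed.

Lemma edist_refl x y : edist (refl nu c x) (refl nu c y) = edist x y.
Proof. by rewrite /edist refl_sub /enorm dot_reflv. Qed.

Lemma refl_sqdist z s :
  dot (refl nu c z - s) (refl nu c z - s) =
  dot (z - s) (z - s) + 4 * (dot nu z - c) * (dot nu s - c).
Proof.
rewrite /refl !dotlin nu1 (dotC z nu) (dotC s nu) (dotC s z); lra.
Qed.

Lemma refl_closer z s : dot nu s <= c -> c <= dot nu z ->
  edist (refl nu c z) s <= edist z s.
Proof.
by move=> hs hz; apply: enorm_le; rewrite refl_sqdist gerDl; nra.
Qed.

Lemma refl_farther z s : dot nu s <= c -> dot nu z <= c ->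
  edist z s <= edist (refl nu c z) s.
Proof.
by move=> hs hz; apply: enorm_le; rewrite refl_sqdist lerDl; nra.
Qed.

End Reflection.

(** * Geodesics in the double *)

(** Polarisation turns the distances into inner products, and equality in the
    Cauchy-Schwarz inequality then makes all the [f t - f t0] multiples of one
    vector. *)
Lemma isometric_line {R : realType} {n : nat} (f : R -> 'rV[R]_n) (t0 r : R) :
  0 < r ->
  (forall s t, `|s - t0| < r -> `|t - t0| < r -> edist (f s) (f t) = `|s - t|) ->
  exists2 V : 'rV[R]_n, dot V V = 1 &
    forall t, `|t - t0| < r -> f t = f t0 + (t - t0) *: V.
Proof.
move=> r0 iso; pose h := r / 2.
have h0 : 0 < h by rewrite divr_gt0.
have c0 : `|t0 - t0| < r by rewrite subrr normr0.
have ch : `|t0 + h - t0| < r by rewrite addrC addKr gtr0_norm // /h; lra.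
have [g gsub gE] : exists2 g : R -> 'rV[R]_n,
    (forall s t, f s - f t = g s - g t) & forall t, f t = f t0 + g t.
  exists (fun t => f t - f t0) => [s t|t]; last by rewrite addrC subrK.
  by rewrite opprB addrA subrK.
have iso2 s t : `|s - t0| < r -> `|t - t0| < r ->
    dot (f s - f t) (f s - f t) = (s - t) ^+ 2.
  by move=> hs ht; rewrite -enorm_sqr -/(edist _ _) iso // real_normK ?num_real.
have gg t : `|t - t0| < r -> dot (g t) (g t) = (t - t0) ^+ 2.
  by move=> ht; rewrite -iso2 // gE addrC addKr.
have gh t : `|t - t0| < r -> dot (g t) (g (t0 + h)) = (t - t0) * h.
  move=> ht; have := iso2 _ _ ht ch; have := gg _ ht; have := gg _ ch.
  rewrite gsub !dotlin (dotC (g (t0 + h)) (g t)) => -> ->; lra.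
have ghh : dot (g (t0 + h)) (g (t0 + h)) = h ^+ 2.
  by rewrite gg //; congr (_ ^+ 2); rewrite addrC addKr.
exists (h^-1 *: g (t0 + h)); first by rewrite !dotlin ghh; field; rewrite gt_eqF.
move=> t ht; rewrite (gE t); congr (_ + _); apply/eqP.
rewrite -subr_eq0; apply/eqP/dot_eq0; rewrite !dotlin (dotC (g (t0 + h)) (g t)) ghh gh // gg //.
by field; rewrite gt_eqF.
Qed.

Section Double.
Context {R : realType} {n : nat} (P : set 'rV[R]_n).
Hypothesis hP : convex_polyhedron P.
Implicit Types (x y z nu v : 'rV[R]_n) (c : R) (A B : 'rV[R]_n * bool).

Lemma ddist_lbound x y : has_lbound [set edist x b + edist b y | b in bdry P].
Proof. by exists 0 => _ [b _ <-]; rewrite addr_ge0 ?edist_ge0. Qed.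

Lemma ddist_le A B b : bdry P b -> ddist P A B <= edist A.1 b + edist b B.1.
Proof.
move=> hb; rewrite /ddist; case: ifP => _; first exact: edist_triangle.
by apply: ge_inf; [exact: ddist_lbound | exists b].
Qed.

Lemma edist_le_ddist A B : bdry P !=set0 -> edist A.1 B.1 <= ddist P A B.
Proof.
move=> [b0 hb0]; rewrite /ddist; case: ifP => // _; apply: lb_le_inf.
  by exists (edist A.1 b0 + edist b0 B.1), b0.
by move=> _ [b _ <-]; apply: edist_triangle.
Qed.

(** Flat chart of the double around a facet: the second copy of the polyhedron
    is laid out as the mirror image of the first one. *)
Definition unfold nu c A : 'rV[R]_n := if A.2 then A.1 else refl nu c A.1.

(** The infimum is attained where the segment from [p] to the mirror image of [q]
    crosses the facet. Boundary points outside the ball on which [P] is a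
    half-space cannot compete: [p] and [q] are so close to [y] that the detour is
    longer. *)
Lemma inf_via_facet nu c y r p q : supporting P nu c -> dot nu y = c ->
  (forall x, edist y x < r ->
    (P x <-> dot nu x <= c) /\ (interior P x <-> dot nu x < c)) ->
  P p -> P q -> edist y p < r / 4 -> edist y q < r / 4 ->
  inf [set edist p b + edist b q | b in bdry P] = edist p (refl nu c q).
Proof.
move=> sP yc hr Pp Pq yp yq; have [nu1 hnu] := sP.
have reflE b : dot nu b = c -> edist b (refl nu c q) = edist b q.
  by move=> bc; rewrite -{1}(refl_fix bc) edist_refl.
have pq : edist p (refl nu c q) < r / 2.
  have := edist_triangle y p (refl nu c q); rewrite (edistC p y) (reflE y) //; lra.
pose al := c - dot nu p; pose be := c - dot nu q.
have al0 : 0 <= al by rewrite subr_ge0 hnu.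
have be0 : 0 <= be by rewrite subr_ge0 hnu.
pose th := al / (al + be).
have th01 : 0 <= th <= 1.
  rewrite /th; have [->|ab] := eqVneq (al + be) 0; first by rewrite invr0 mulr0 lexx ler01.
  have ab0 : 0 < al + be by rewrite lt0r ab addr_ge0.
  apply/andP; split; first by rewrite divr_ge0 // ltW.
  by rewrite ler_pdivrMr // mul1r lerDl.
pose b := p + th *: (refl nu c q - p).
have bc : dot nu b = c.
  rewrite /b dotDr dotZr dotBr dot_refl //.
  have -> : 2 * c - dot nu q - dot nu p = al + be by rewrite /al /be; lra.
  rewrite /th; have [ab|ab] := eqVneq (al + be) 0.
    by rewrite ab mulr0 addr0; move: al0 be0 ab; rewrite /al /be; lra.
  by rewrite divfK // /al; lra.
have pb : edist p b = th * edist p (refl nu c q).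
  by rewrite /b edist_shift ger0_norm ?(andP th01).1 // -/(edist _ _) edistC.
have bq : edist b q = (1 - th) * edist p (refl nu c q).
  rewrite -reflE // /edist.
  have -> : b - refl nu c q = (1 - th) *: (p - refl nu c q).
    by apply/rowP => i; rewrite /b !mxE; lra.
  by rewrite enormZ ger0_norm // subr_ge0 (andP th01).2.
have bP : bdry P b.
  apply: (support_bdry hP sP) => //.
  apply/(hr _ _).1; last by rewrite bc.
  have := edist_triangle p y b; rewrite pb.
  have := edist_ge0 p (refl nu c q); case/andP: th01; nra.
apply/eqP; rewrite eq_le; apply/andP; split.
  apply: (@le_trans _ _ (edist p b + edist b q)).
    by apply: ge_inf; [exact: ddist_lbound | exists b].
  by rewrite pb bq; lra.
apply: lb_le_inf; first by exists (edist p b + edist b q), b.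
move=> _ [b' /(polyhedron_bdryP hP)[Pb' nb'] <-].
have [yb|yb] := ltP (edist y b') r.
  have bc' : dot nu b' = c.
    apply/eqP; rewrite eq_le hnu //= leNgt; apply/negP => h.
    by apply: nb'; apply/(hr _ yb).2.
  by rewrite -reflE //; apply: edist_triangle.
have := edist_triangle p y b'; have := edist_triangle q y b'.
by have := edist_ge0 y p; rewrite (edistC q b'); lra.
Qed.

Lemma unfold_isometry nu c y r A B : supporting P nu c -> dot nu y = c ->
  (forall x, edist y x < r ->
    (P x <-> dot nu x <= c) /\ (interior P x <-> dot nu x < c)) ->
  P A.1 -> P B.1 -> edist y A.1 < r / 4 -> edist y B.1 < r / 4 ->
  edist (unfold nu c A) (unfold nu c B) = ddist P A B.
Proof.
move=> sP yc hr; case: A => p a; case: B => q b /= Pp Pq yp yq.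
have nu1 := sP.1; rewrite /unfold /ddist /=.
case: a; case: b => //=; first by rewrite (inf_via_facet sP yc hr).
  by rewrite (inf_via_facet sP yc hr) // -{1}(reflK c nu1 q) edist_refl.
by rewrite edist_refl.
Qed.

Section Geodesic.
Variable g : R -> 'rV[R]_n * bool.
Hypothesis g0 : forall t : R, double0 P (g t).
Hypothesis giso : forall t0 : R, exists2 r : R, 0 < r & forall s t : R,
  `|s - t0| < r -> `|t - t0| < r -> ddist P (g s) (g t) = `|s - t|.
Hypothesis bP : bdry P !=set0.

Lemma geodesic_in t : P (g t).1.
Proof. by have [[]] := g0 t. Qed.

Lemma geodesic_off_skeleton t : ~ skeleton P (g t).1.
Proof.
move=> sk; have [[_ b] ns] := g0 t; apply: ns; split=> //.
by apply: b; apply: skeleton_bdry.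
Qed.

Lemma geodesic_flag_facet t : ~ interior P (g t).1 -> (g t).2 = true.
Proof.
move=> ni; have [[_ b] _] := g0 t; apply: b.
by apply/(polyhedron_bdryP hP); split=> //; apply: geodesic_in.
Qed.

(** Near an interior point the geodesic cannot change copies, which would cost a
    detour to the boundary. *)
Lemma geodesic_interior t0 : interior P (g t0).1 ->
  exists V : 'rV[R]_n, exists2 r : R, 0 < r & forall t, `|t - t0| < r ->
    g t = ((g t0).1 + (t - t0) *: V, (g t0).2).
Proof.
move=> /interiorP[d d0 hd].
have [r r0 iso] := giso t0.
pose e := Num.min r d.
have e0 : 0 < e by rewrite lt_min r0.
have er t : `|t - t0| < e -> `|t - t0| < r by rewrite lt_min => /andP[].
have c0 : `|t0 - t0| < r by rewrite subrr normr0.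
have flag t : `|t - t0| < e -> (g t).2 = (g t0).2.
  move=> ht; apply: contrapT => /eqP ne; have := iso _ _ (er _ ht) c0.
  rewrite /ddist (negPf ne) => E.
  suff : d <= `|t - t0| by move: ht; rewrite lt_min ltNge => /andP[_]; rewrite ltNge => /negP.
  rewrite -E; apply: lb_le_inf.
    by case: bP => b hb; exists (edist (g t).1 b + edist b (g t0).1), b.
  move=> _ [b hb <-]; apply: (@le_trans _ _ (edist (g t0).1 b)).
    rewrite leNgt; apply/negP => /(interior_edist hd).
    by case/(polyhedron_bdryP hP): hb.
  by rewrite edistC lerDr edist_ge0.
have [|V _ hV] := @isometric_line _ _ (fun t => (g t).1) t0 e e0.
  by move=> s t hs ht; rewrite -iso ?er // /ddist (flag s hs) (flag t ht) eqxx.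
exists V, e => // t ht; rewrite -hV // -(flag t ht).
by case: (g t).
Qed.

(** In the chart the second copy lies beyond the hyperplane of the facet, so that
    the side of this hyperplane on which the line runs tells the copy in which the
    geodesic runs. *)
Lemma geodesic_facet t0 nu c : supporting P nu c -> dot nu (g t0).1 = c ->
  exists V : 'rV[R]_n, exists2 r : R, 0 < r & forall t, `|t - t0| < r ->
    unfold nu c (g t) = (g t0).1 + (t - t0) *: V /\
    (g t).2 = ((t - t0) * dot nu V <= 0).
Proof.
move=> sP yc; set y := (g t0).1 in yc *.
have [d d0 hd] :=
  facet_half_space hP sP yc (geodesic_in t0) (@geodesic_off_skeleton t0).
have [r r0 iso] := giso t0.
pose e := Num.min r (d / 4).
have e0 : 0 < e by rewrite lt_min r0 divr_gt0.
have er t : `|t - t0| < e -> `|t - t0| < r by rewrite lt_min => /andP[].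
have c0 : `|t0 - t0| < r by rewrite subrr normr0.
have near t : `|t - t0| < e -> edist y (g t).1 < d / 4.
  move=> ht; rewrite edistC; apply: le_lt_trans (edist_le_ddist _ _ bP) _.
  by rewrite (iso _ _ (er _ ht) c0); move: ht; rewrite lt_min => /andP[].
have [|V _ hV] := @isometric_line _ _ (fun t => unfold nu c (g t)) t0 e e0.
  move=> s t hs ht; rewrite (unfold_isometry sP yc hd) ?near ?iso ?er //;
    exact: geodesic_in.
have u0 : unfold nu c (g t0) = y.
  by rewrite /unfold; case: ifP => // _; rewrite refl_fix.
exists V, e => // t ht; rewrite -{1}u0; split; first exact: hV.
have := hV t ht; rewrite u0 => /(congr1 (dot nu)); rewrite !dotlin yc => E.
have Pt := geodesic_in t.
move: E; rewrite /unfold; case E2 : (g t).2 => E.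
  by have h := sP.2 _ Pt; apply/esym; lra.
have lt : dot nu (g t).1 < c.
  apply/(hd _ _).2; first by apply: lt_le_trans (near _ ht) _; lra.
  by apply: contrapT => /geodesic_flag_facet; rewrite E2.
by move: E; rewrite dot_refl ?sP.1 // => E; apply/esym/negbTE; rewrite -ltNge; lra.
Qed.

Lemma geodesic_endpoint t0 r y v b : 0 < r ->
  (forall t, t0 - r < t < t0 -> g t = (y + (t - t0) *: v, b)) ->
  dot v v = 1 -> (g t0).1 = y.
Proof.
move=> r0 hg v1; apply: edist_eq0; apply/eqP; rewrite eq_le edist_ge0 andbT.
rewrite leNgt; apply/negP => d0; set d := edist _ _ in d0.
have [r' r'0 iso] := giso t0.
pose e := Num.min (Num.min r r') (d / 2) / 2.
have e0 : 0 < e by rewrite divr_gt0 // !lt_min r0 r'0 divr_gt0.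
have e2 : e * 2 = Num.min (Num.min r r') (d / 2) by rewrite divfK.
have : e * 2 <= r /\ e * 2 <= r' /\ e * 2 <= d / 2.
  by rewrite e2; split; [|split]; rewrite !ge_min lexx ?orbT.
move=> [er [er' ed]].
have et : `|t0 - e - t0| = e by rewrite addrC addKr normrN gtr0_norm.
have i0 : `|t0 - t0| < r' by rewrite subrr normr0.
have ie : `|t0 - e - t0| < r' by rewrite et; lra.
have te : t0 - r < t0 - e < t0 by apply/andP; split; lra.
have := edist_triangle (g (t0 - e)).1 (g t0).1 y; rewrite -/d.
have := edist_le_ddist (g t0) (g (t0 - e)) bP.
rewrite (iso _ _ i0 ie) distrC et (hg _ te) /=.
by rewrite (edistC (y + _)) edist_shift enorm1 // et; lra.
Qed.

(** By transversality the line in the chart passes from one side of the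
    hyperplane to the other, hence from one copy to the other. *)
Lemma geodesic_cross t0 r nu c y v b : 0 < r -> supporting P nu c ->
  dot nu y = c -> dot v v = 1 -> 0 < dot nu v ->
  (forall t, t0 - r < t < t0 -> g t = (y + (t - t0) *: v, b)) ->
  exists2 r' : R, 0 < r' & forall t, t0 < t < t0 + r' ->
    g t = (y + (t - t0) *: reflv nu v, ~~ b).
Proof.
move=> r0 sP yc v1 nv hg.
have gy := geodesic_endpoint r0 hg v1.
have nu1 := sP.1.
have [V [r' r'0 hV]] : exists V : 'rV[R]_n, exists2 r : R, 0 < r &
    forall t, `|t - t0| < r -> unfold nu c (g t) = y + (t - t0) *: V /\
    (g t).2 = ((t - t0) * dot nu V <= 0).
  by rewrite -gy; apply: geodesic_facet => //; rewrite gy.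
pose e := Num.min r r' / 2.
have e0 : 0 < e by rewrite divr_gt0 // lt_min r0.
have e2 : e * 2 = Num.min r r' by rewrite divfK.
have [er er'] : e * 2 <= r /\ e * 2 <= r'.
  by rewrite e2; split; rewrite !ge_min lexx ?orbT.
have et : `|t0 - e - t0| = e by rewrite addrC addKr normrN gtr0_norm.
have [|] := hV (t0 - e); first by rewrite et; lra.
have em : t0 - e - t0 = - e by rewrite addrC addKr.
have te : t0 - r < t0 - e < t0 by apply/andP; split; lra.
rewrite (hg _ te) em /unfold /= => hV1 _.
(* In the chart the geodesic is a line, so its direction before the crossing
   determines it after the crossing. *)
have [VE nV] : V = (if b then v else reflv nu v) /\ dot nu V = (if b then dot nu v else - dot nu v).
  suff VE : V = (if b then v else reflv nu v).
    by split=> //; rewrite VE; case: (b) => //; rewrite dot_reflv_nu.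
  have ne : - e != 0 by rewrite oppr_eq0 gt_eqF.
  move: hV1; case: (b) => [/addrI /(scalerI ne) //|].
  by rewrite refl_line // refl_fix // => /addrI /(scalerI ne).
exists r' => // t /andP[t1 t2].
have [|U1 U2] := hV t; first by rewrite gtr0_norm ?subr_gt0 // ltrBlDl.
have dt : 0 < t - t0 by rewrite subr_gt0.
move: U1 U2; rewrite /unfold nV VE; case: (g t) => x a /=.
case: (b) => /=.
  have -> : ((t - t0) * dot nu v <= 0) = false.
    by apply/negbTE; rewrite -ltNge mulr_gt0.
  move=> U1 aF; move: U1; rewrite aF => /(congr1 (refl nu c)).
  by rewrite reflK // refl_line // refl_fix // => ->.
have -> : (t - t0) * - dot nu v <= 0 by rewrite mulrN oppr_le0 ltW // mulr_gt0.
by move=> U1 aT; move: U1; rewrite aT => ->.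
Qed.

(** At the supremum of the times until which the geodesic follows the line, it is
    at an interior point, where it is straight and hence keeps its direction. *)
Lemma geodesic_flight T tau r y v b : 0 < r -> dot v v = 1 ->
  (forall s, 0 < s < tau -> interior P (y + s *: v)) ->
  (forall t, T < t < T + r -> g t = (y + (t - T) *: v, b)) ->
  forall t, T < t < T + tau -> g t = (y + (t - T) *: v, b).
Proof.
move=> r0 v1 hint hstart t1 /andP[t1T t1tau]; apply: contrapT => bad.
pose ok t := T < t /\ forall t', T < t' <= t -> g t' = (y + (t' - T) *: v, b).
have ok_lt t : ok t -> t < t1.
  by move=> [_ ht]; rewrite ltNge; apply/negP => h; apply: bad; apply: ht; rewrite t1T.
have okr : ok (T + r / 2).
  split; first by lra.
  by move=> t' /andP[h1 h2]; apply: hstart; rewrite h1; lra.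
have ub : has_ubound ok by exists t1 => t /ok_lt/ltW.
pose s := sup ok.
have rs : T + r / 2 <= s by apply: ub_le_sup.
have st1 : s <= t1 by apply: ge_sup; [exists (T + r / 2) | move=> t /ok_lt/ltW].
have below t : T < t < s -> g t = (y + (t - T) *: v, b).
  move=> /andP[tT ts]; have [|//|t' [_ ht'] hs] := @sup_adherent _ ok (s - t).
  - by rewrite subr_gt0.
  - by split; [exists (T + r / 2) | ].
  by apply: ht'; rewrite tT; move: hs; rewrite opprB addrC subrK => /ltW.
have gs : (g s).1 = y + (s - T) *: v.
  apply: (@geodesic_endpoint s (r / 2) _ v b) => //; first by lra.
  move=> t /andP[h1 h2]; rewrite below; last by apply/andP; split; lra.
  by congr (_, _); apply/rowP => i; rewrite !mxE; ring.
have ints : interior P (g s).1 by rewrite gs; apply: hint; apply/andP; split; lra.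
have [V [d d0 hV]] := geodesic_interior ints.
pose e := Num.min d (r / 2) / 2.
have e0 : 0 < e by rewrite divr_gt0 // lt_min d0 divr_gt0.
have e2 : e * 2 = Num.min d (r / 2) by rewrite divfK.
have [ed er] : e * 2 <= d /\ e * 2 <= r / 2.
  by rewrite e2; split; rewrite !ge_min lexx ?orbT.
have em : s - e - s = - e by rewrite addrC addKr.
have se : T < s - e < s by apply/andP; split; lra.
have /hV : `|s - e - s| < d by rewrite em normrN gtr0_norm //; lra.
rewrite below // em gs => -[VE bE].
have {}VE : V = v.
  have ne : - e != 0 by rewrite oppr_eq0 gt_eqF.
  apply: (scalerI ne); apply: (addrI (y + (s - T) *: v)).
  by rewrite -VE; apply/rowP => i; rewrite !mxE; ring.
have : ok (s + e).
  split; first by lra.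
  move=> t /andP[h1 h2]; have [ts|ts] := ltP t s; first by rewrite below ?h1.
  rewrite hV; last by rewrite ger0_norm ?subr_ge0 //; lra.
  by rewrite gs VE -bE; congr (_, _); apply/rowP => i; rewrite !mxE; ring.
by move=> /(ub_le_sup ub); rewrite -/s; lra.
Qed.

(** If the meeting times were bounded, they would accumulate at a time around
    which the geodesic is, in a chart, a line near at most one facet. This line
    would meet the facet again and again, hence stay in it, which excludes flights
    through the interior. *)
Lemma geodesic_nonzeno (T : nat -> R) : (forall i, T i < T i.+1) ->
  (forall i, bdry P (g (T i)).1) ->
  (forall i t, T i < t < T i.+1 -> interior P (g t).1) ->
  forall M, exists i, M < T i.
Proof.
move=> incT bT intT M; apply: contrapT => none.
have TB i : T i <= M by rewrite leNgt; apply/negP => h; apply: none; exists i.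
have mono i j : (i <= j)%N -> T i <= T j.
  by move=> ij; apply: (@homo_leq _ T _ lexx le_trans) => // k; apply: ltW.
pose A := range T.
have ubA : has_ubound A by exists M => _ [i _ <-].
pose s := sup A.
have Ts i : T i < s.
  by apply: lt_le_trans (incT i) _; apply: ub_le_sup => //; exists i.+1.
have nears e : 0 < e -> exists i, s - e < T i.
  move=> e0; have [//|_ [i _ <-] h] := @sup_adherent _ A e e0; last by exists i.
  by split; [exists (T 0%N), 0%N | ].
have [ints|nints] := pselect (interior P (g s).1).
  have [V [d d0 hV]] := geodesic_interior ints.
  have /interiorP[r r0 hr] := ints.
  pose e := Num.min d (r / (enorm V + 1)).
  have v0 : 0 < enorm V + 1 by rewrite ltr_wpDl ?enorm_ge0.
  have e0 : 0 < e by rewrite lt_min d0 divr_gt0.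
  have [i hi] := nears _ e0.
  have ie : `|T i - s| < e by rewrite ltr0_norm ?subr_lt0 //; lra.
  have := bT i; rewrite hV /=; last by move: ie; rewrite lt_min => /andP[].
  move=> /(polyhedron_bdryP hP)[_]; apply; apply: (interior_edist hr).
  rewrite edist_shift.
  have : `|T i - s| < r / (enorm V + 1) by move: ie; rewrite lt_min => /andP[].
  rewrite ltr_pdivlMr //; have := normr_ge0 (T i - s); lra.
have [nu [c [sP sc _]]] :=
  locally_half_space hP (geodesic_in s) (@geodesic_off_skeleton s) nints.
have [V [d d0 hV]] := geodesic_facet sP sc.
have [r r0 hr] :=
  facet_half_space hP sP sc (geodesic_in s) (@geodesic_off_skeleton s).
have [r' r'0 iso] := giso s.
pose e := Num.min d (Num.min r r').
have e0 : 0 < e by rewrite !lt_min d0 r0.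
have [i hi] := nears _ e0.
have close t : T i <= t < s -> [/\ `|t - s| < d, `|t - s| < r & `|t - s| < r'].
  move=> /andP[h1 h2]; apply/and3P; rewrite -!lt_min ltr0_norm ?subr_lt0 //.
  by move: hi; rewrite /e; lra.
have [ci1 ci2 ci3] : [/\ `|T i - s| < d, `|T i - s| < r & `|T i - s| < r'].
  by apply: close; rewrite lexx Ts.
have on_facet : dot nu (g (T i)).1 = c.
  apply/eqP; rewrite eq_le (sP.2 _ (geodesic_in _)) /= leNgt; apply/negP => lt.
  case/(polyhedron_bdryP hP): (bT i) => _; apply; apply/(hr _ _).2 => //.
  rewrite edistC; apply: le_lt_trans (edist_le_ddist _ _ bP) _.
  by rewrite iso ?subrr ?normr0.
have nV : dot nu V = 0.
  have [+ _] := hV _ ci1; rewrite /unfold; case: ifP => _.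
    move=> /(congr1 (dot nu)); rewrite on_facet !dotlin sc => /eqP.
    rewrite -subr_eq0 opprD addrA subrr add0r oppr_eq0 mulf_eq0 subr_eq0.
    by rewrite lt_eqF //= => /eqP.
  rewrite refl_fix // => /(congr1 (dot nu)); rewrite on_facet !dotlin sc => /eqP.
  rewrite -subr_eq0 opprD addrA subrr add0r oppr_eq0 mulf_eq0 subr_eq0.
  by rewrite lt_eqF //= => /eqP.
pose t := (T i + T i.+1) / 2.
have tT : T i < t < T i.+1 by have := incT i; rewrite /t => h; apply/andP; split; lra.
have [ct _ _] : [/\ `|t - s| < d, `|t - s| < r & `|t - s| < r'].
  by apply: close; have := Ts i.+1; case/andP: tT; lra.
have [+ ft] := hV _ ct; rewrite /unfold ft nV mulr0 lexx.
move=> /(congr1 (dot nu)); rewrite !dotlin sc nV mulr0 addr0 => on.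
by apply: (support_not_interior sP on); apply: intT tT.
Qed.

End Geodesic.
End Double.

(** * Unfolding the billiard along a word *)

Fixpoint dir {R : realType} {n : nat} (nu : nat -> 'rV[R]_n) (v : 'rV[R]_n)
    (i : nat) : 'rV[R]_n :=
  if i is j.+1 then reflv (nu i) (dir nu v j) else v.

(** The reflections start with the facet of index 1: the facet of index 0 is the
    one that the trajectory leaves. *)
Fixpoint fold {R : realType} {n : nat} (nu : nat -> 'rV[R]_n) (c : nat -> R)
    (i : nat) (z : 'rV[R]_n) : 'rV[R]_n :=
  if i is j.+1 then refl (nu i) (c i) (fold nu c j z) else z.

Section Word.
Context {R : realType} {n : nat} (P : set 'rV[R]_n).
Hypothesis hP : convex_polyhedron P.
Variables (nu : nat -> 'rV[R]_n) (c : nat -> R) (v : 'rV[R]_n).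
Hypothesis sup : forall i, supporting P (nu i) (c i).
Hypothesis v1 : dot v v = 1.
Implicit Types (x y z s : 'rV[R]_n) (t : R).

Notation dir := (dir nu v).
Notation fold := (fold nu c).

Let nu1 i : dot (nu i) (nu i) = 1 := (sup i).1.

(** The time at which the image under [fold i] of the line through [z] crosses
    the hyperplane of the [i]-th facet. *)
Definition hit i z : R := (c i - dot (nu i) (fold i z)) / dot (nu i) (dir i).

Definition land i z : 'rV[R]_n := fold i (z + hit i z *: v).

Definition good z : Prop := forall i, P (land i z) /\ ~ skeleton P (land i z).

Lemma dot_dir i : dot (dir i) (dir i) = 1.
Proof. by elim: i => [|i IH] //=; rewrite dot_reflv. Qed.

Lemma fold_line i z t : fold i (z + t *: v) = fold i z + t *: dir i.
Proof. by elim: i => [|i IH] //=; rewrite IH refl_line. Qed.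

Lemma edist_fold i x y : edist (fold i x) (fold i y) = edist x y.
Proof. by elim: i => [|i IH] //=; rewrite edist_refl. Qed.

Lemma fold_affine i x y t :
  fold i (x + t *: (y - x)) = fold i x + t *: (fold i y - fold i x).
Proof.
elim: i => [|i IH] //=; rewrite IH /refl; apply/rowP => k.
by rewrite !mxE !dotlin; ring.
Qed.

Lemma land_affine i x y t :
  land i (x + t *: (y - x)) = land i x + t *: (land i y - land i x).
Proof.
rewrite /land !fold_line fold_affine; apply/rowP => k.
by rewrite !mxE /hit fold_affine !dotlin; ring.
Qed.

Hypothesis inc : forall i, dot (nu i) (dir i) < 0.
Hypothesis out : forall i, 0 < dot (nu i.+1) (dir i).

Lemma dot_land i z : dot (nu i) (land i z) = c i.
Proof.
rewrite /land fold_line !dotlin /hit divfK; last by rewrite lt_eqF.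
by rewrite addrC subrK.
Qed.

Lemma land_prev i z : land i.+1 z = fold i (z + hit i.+1 z *: v).
Proof.
rewrite -[RHS](reflK (c i.+1) (nu1 i.+1)).
by rewrite -[refl _ _ (fold _ _)]/(land i.+1 z) refl_fix // dot_land.
Qed.

Lemma land_step i z :
  land i.+1 z = land i z + (hit i.+1 z - hit i z) *: dir i.
Proof.
by rewrite land_prev /land !fold_line; apply/rowP => k; rewrite !mxE; ring.
Qed.

Lemma hit_unique i z t : dot (nu i.+1) (fold i (z + t *: v)) = c i.+1 ->
  t = hit i.+1 z.
Proof.
have := dot_land i.+1 z; rewrite land_prev !fold_line !dotlin => <- /addrI.
by apply: mulIf; rewrite gt_eqF.
Qed.

Lemma hit_le i z : P (land i z) -> hit i z <= hit i.+1 z.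
Proof.
move=> /(sup i.+1).2; have := dot_land i.+1 z.
rewrite land_step !dotlin => <-; rewrite lerDl.
by rewrite pmulr_lge0 // subr_ge0.
Qed.

(** Simultaneous hits would put the landing point on two facets, which are
    distinct because the direction enters through one and exits through the
    other. *)
Lemma hit_lt i z : P (land i z) -> ~ skeleton P (land i z) ->
  hit i z < hit i.+1 z.
Proof.
move=> Pz nsk; rewrite lt_neqAle hit_le // andbT; apply/eqP => e; apply: nsk.
apply: (two_supports_skeleton hP (sup i) (sup i.+1)) => //; last 2 first.
- exact: dot_land.
- by have := dot_land i.+1 z; rewrite land_step e subrr scale0r addr0.
by move=> ne; have := inc i; have := out i; rewrite ne; lra.
Qed.

(** Just after landing on a facet off the skeleton the line enters the interior,
    and from there it sees the next landing point through the interior. *)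
Lemma flight_interior i z t : P (land i z) -> ~ skeleton P (land i z) ->
  P (land i.+1 z) -> hit i z < t < hit i.+1 z -> interior P (fold i (z + t *: v)).
Proof.
move=> Pi nsk Pj /andP[t1 t2].
have [r r0 hr] := facet_half_space hP (sup i) (dot_land i z) Pi nsk.
pose e := Num.min (r / 2) (t - hit i z).
have e0 : 0 < e by rewrite lt_min divr_gt0 // subr_gt0.
have er : e < r by rewrite gt_min; apply/orP; left; lra.
have et : e <= t - hit i z by rewrite ge_min lexx orbT.
have inty : interior P (land i z + e *: dir i).
  apply/(hr _ _).2.
    by rewrite edist_shift enorm1 ?dot_dir // mulr1 gtr0_norm.
  by rewrite !dotlin dot_land; have := inc i; nra.
pose q := (hit i.+1 z - t) / (hit i.+1 z - (hit i z + e)).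
have d0 : 0 < hit i.+1 z - (hit i z + e) by lra.
have -> : fold i (z + t *: v) =
    land i.+1 z + q *: (land i z + e *: dir i - land i.+1 z).
  rewrite land_step /land !fold_line; apply/rowP => k; rewrite !mxE /q.
  by field; rewrite gt_eqF.
apply: interior_segment => //; apply/andP; split.
  by rewrite /q divr_gt0 // subr_gt0.
by rewrite /q ler_pdivrMr // mul1r; lra.
Qed.

Section Closest.
Variables (s z : 'rV[R]_n).
Hypothesis Ps : P s.

Local Notation D i t := (edist (fold i (z + t *: v)) s).

Lemma fold_before i t : t <= hit i.+1 z -> D i t <= D i.+1 t.
Proof.
move=> ht; apply: (@refl_farther _ _ _ _ (nu1 i.+1) (fold i (z + t *: v)) s).
  exact: (sup i.+1).2.
rewrite -(dot_land i.+1 z) land_prev !fold_line !dotlin lerD2l.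
by rewrite ler_wpM2r // ltW.
Qed.

Lemma fold_after i t : hit i.+1 z <= t -> D i.+1 t <= D i t.
Proof.
move=> ht; apply: (@refl_closer _ _ _ _ (nu1 i.+1) (fold i (z + t *: v)) s).
  exact: (sup i.+1).2.
rewrite -(dot_land i.+1 z) land_prev !fold_line !dotlin lerD2l.
by rewrite ler_wpM2r // ltW.
Qed.

(** Passing from one of the lines to its neighbour on the side of the current
    flight [j] reflects the point at time [t] from the outside of the half-space
    of a facet to its inside, which brings it closer to [s]. *)
Lemma billiard_closest j t i : (forall k, hit k z <= hit k.+1 z) ->
  hit j z <= t <= hit j.+1 z -> D j t <= D i t.
Proof.
move=> mono1 /andP[h1 h2].
have mono k l : (k <= l)%N -> hit k z <= hit l z.
  move=> kl; apply: (@homo_leq _ (hit ^~ z) _ lexx le_trans) => //.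
have [ji|/ltnW ij] := leqP j i.
  rewrite -(subnKC ji); elim: (i - j)%N => [|k IH]; first by rewrite addn0.
  apply: le_trans IH _; rewrite addnS; apply: fold_before.
  by apply: le_trans h2 _; apply: mono; rewrite ltnS leq_addr.
have -> : i = (j - (j - i))%N by rewrite subKn.
elim: (j - i)%N => [|k IH]; first by rewrite subn0.
apply: le_trans IH _; have [jk|kj] := leqP j k.
  have -> : (j - k = 0)%N by apply/eqP; rewrite subn_eq0.
  by have -> : (j - k.+1 = 0)%N by apply/eqP; rewrite subn_eq0 ltnW // ltnS.
have -> : (j - k = (j - k.+1).+1)%N by rewrite subnSK.
apply: fold_after; apply: le_trans h1; apply: mono.
by rewrite subnSK // leq_subr.
Qed.

End Closest.

(** Moving from [z0] towards a line that is not good, some landing point reaches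
    the skeleton before it leaves its facet, and the line through [z0], under the
    same [fold i], comes close to this point. The term in [dot (nu 0) v] accounts
    for this happening possibly before the first landing time [hit 0 z0]. *)
Lemma good_ball z0 (e d : R) : good z0 ->
  (forall i t s, hit 0 z0 < t -> skeleton P s ->
     e <= edist (fold i (z0 + t *: v)) s) ->
  0 <= d -> d * (1 + (- dot (nu 0) v)^-1) < e ->
  forall z, edist z0 z <= d -> good z.
Proof.
move=> good0 far d0 de.
pose K := (- dot (nu 0) v)^-1.
have k0 : 0 < - dot (nu 0) v by rewrite oppr_gt0; have := inc 0%N.
have K0 : 0 < K by rewrite invr_gt0.
have hit0 z : edist z0 z <= d -> hit 0 z0 - hit 0 z <= K * d.
  move=> hz; rewrite /hit /= -mulrBl -[X in _ * X]opprK -invrN mulrN -mulNr mulrC.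
  by rewrite ler_wpM2l ?(ltW K0) //; have := unit_gap z z0 (nu1 0%N); rewrite edistC; lra.
move=> z hz i; elim/ltn_ind: i z hz => i IH z hz.
apply: contrapT => bad.
have [th th01 sk] := facet_exit_skeleton hP (sup i) (dot_land i z0)
  (dot_land i z) (good0 i).1 bad.
rewrite -land_affine in sk; set y := z0 + _ in sk.
have yd : edist z0 y <= d.
  apply: le_trans hz; case/andP: th01 => th0 th1.
  rewrite /y edist_shift ger0_norm // -/(edist z z0) edistC ler_piMl //.
  exact: edist_ge0.
have hit0i : hit 0 y <= hit i y.
  have : forall k, (k < i.+1)%N -> hit 0 y <= hit k y.
    elim=> [//|k IHk ki]; apply: le_trans (IHk (ltnW ki)) _.
    by apply: hit_le; apply: (IH k ki y yd).1.
  exact.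
pose x := (e - d * (1 + K)) / 2.
have x0 : 0 < x by rewrite divr_gt0 // subr_gt0.
have := hit0 _ yd; set t := Num.max (hit i y) (hit 0 z0) + x => h0.
have t0 : hit 0 z0 < t by rewrite ltr_pwDr // le_max lexx orbT.
have := far i t _ t0 sk.
have := edist_triangle (fold i (y + t *: v)) (fold i (z0 + t *: v)) (land i y).
have le_t : hit i y <= t by rewrite ler_wpDr ?(ltW x0) // le_max lexx.
have t_le : t - hit i y <= K * d + x.
  rewrite addrAC lerD2r lerBlDr ge_max; apply/andP; split; last by lra.
  by rewrite lerDr mulr_ge0 // ltW.
rewrite /land !edist_fold edist_addr edist_line enorm1 // mulr1.
rewrite ger0_norm ?subr_ge0 //; have : x * 2 = e - d * (1 + K) by rewrite divfK.
lra.
Qed.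

End Word.

Section Itinerary.
Context {R : realType} {n : nat} (P : set 'rV[R]_n).
Hypothesis hP : convex_polyhedron P.
Variables (w : nat -> set 'rV[R]_n).

Definition word_normals (nu : nat -> 'rV[R]_n) (c : nat -> R) : Prop :=
  forall i, [/\ facet P (nu i) (w i), supporting P (nu i) (c i) &
    w i = P `&` [set x | dot (nu i) x = c i]].

Lemma word_normals_exist :
  (forall i, exists nu, facet P nu (w i)) -> exists nu c, word_normals nu c.
Proof.
move=> h; have /choice[f hf] : forall i, exists p : 'rV[R]_n * R,
    [/\ facet P p.1 (w i), supporting P p.1 p.2 &
      w i = P `&` [set x | dot p.1 x = p.2]].
  move=> i; have [nu fi] := h i; have [[nu1 [c hc wE]] _] := fi.
  by exists (nu, c).
by exists (fun i => (f i).1), (fun i => (f i).2).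
Qed.

Variables (nu : nat -> 'rV[R]_n) (c : nat -> R) (v : 'rV[R]_n).
Hypothesis nuc : word_normals nu c.
Hypothesis v1 : dot v v = 1.

Let sup i : supporting P (nu i) (c i). Proof. by case: (nuc i). Qed.

Lemma word_on_facet i x : w i x -> P x /\ dot (nu i) x = c i.
Proof. by case: (nuc i) => _ _ -> []. Qed.

Section Orbit.
Variable u : nat -> 'rV[R]_n * 'rV[R]_n.
Hypothesis u0 : (u 0%N).2 = v.
Hypothesis ret : forall i, return_map P (u i) (u i.+1).
Hypothesis nsk : forall i, ~ skeleton P (u i).1.
Hypothesis uw : forall i, w i (u i).1.

(** The facet in which [return_map] reflects is determined only through the
    landing point. Off the skeleton, this makes it the facet prescribed by the
    word. *)
Lemma orbit_dir i : (u i).2 = dir nu v i.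
Proof.
elim: i => [//|i IH]; have [tau _ [_ _ [nu' [G [[f' _] Gy ->]]]]] := ret i.
have [Py yc] := word_on_facet (uw i.+1).
have -> : nu' = nu i.+1.
  have [nu1' [c' hc GE]] := f'; apply: contrapT => ne; apply: (@nsk i.+1).
  have sG : supporting P nu' c' by [].
  by apply: (two_supports_skeleton hP sG (sup i.+1)) => //; move: Gy; rewrite GE => -[].
by rewrite IH.
Qed.

Lemma orbit_out i : 0 < dot (nu i.+1) (dir nu v i).
Proof.
have [tau tau0 [E fl _]] := ret i.
have [_ yc] := word_on_facet (uw i.+1).
have h : 0 < tau / 2 < tau by apply/andP; split; lra.
have := interior_lt_support (sup i.+1) (fl _ h).
move: yc; rewrite E orbit_dir !dotlin => <-; rewrite ltrD2l.
by rewrite -subr_gt0 -mulrBl pmulr_rgt0 //; lra.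
Qed.

Lemma orbit_inc i : inward P (u 0%N) -> dot (nu i) (dir nu v i) < 0.
Proof.
move=> inw; case: i => [|i].
  have [_ _ inw0] := inw; have [_ yc] := word_on_facet (uw 0%N).
  have [s [/= si s0]] : exists s : R, interior P ((u 0%N).1 + s *: (u 0%N).2) /\ 0 < s.
    near (0 : R)^'+ => s; exists s; split => //.
    by near: s.
  have := interior_lt_support (sup 0%N) si.
  by rewrite u0 !dotlin yc -subr_lt0 addrAC subrr add0r pmulr_rlt0.
by rewrite /= dot_reflv_nu ?(sup i.+1).1 // oppr_lt0 orbit_out.
Unshelve. all: by end_near.
Qed.

Hypothesis inc : forall i, dot (nu i) (dir nu v i) < 0.

Lemma orbit_land z t : (u 0%N).1 = z + t *: v ->
  t = hit nu c v 0 z /\ forall i, (u i).1 = land nu c v i z.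
Proof.
move=> E; have out := orbit_out.
have t0 : t = hit nu c v 0 z.
  have [_] := word_on_facet (uw 0%N); rewrite E => yc.
  have n0 : dot (nu 0%N) v != 0 by have := inc 0%N => /lt_eqF ->.
  by rewrite /hit /= -yc !dotlin addrAC subrr add0r mulfK.
split=> //; elim=> [|i IH]; first by rewrite E t0.
have [tau _ [E1 _ _]] := ret i.
have [_] := word_on_facet (uw i.+1); move: E1; rewrite IH orbit_dir => -> yc.
have E1 : land nu c v i z + tau *: dir nu v i =
    fold nu c i (z + (hit nu c v i z + tau) *: v).
  rewrite /land !fold_line; apply/rowP => k.
  by rewrite !mxE; ring.
move: yc; rewrite E1 => /(hit_unique sup inc out) ->.
by rewrite -(land_prev sup inc).
Qed.

End Orbit.

Lemma X_signs y : X_ P w (y, v) -> (forall i, dot (nu i) (dir nu v i) < 0) /\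
  forall i, 0 < dot (nu i.+1) (dir nu v i).
Proof.
move=> [inw [u [u0 ret nsk uw]]].
have u02 : (u 0%N).2 = v by rewrite u0.
have uw' i : w i (u i).1 by case: (uw i).
split=> i; last exact: (orbit_out u02 ret nsk uw').
by apply: (orbit_inc u02 ret nsk uw'); rewrite u0.
Qed.

Hypothesis inc : forall i, dot (nu i) (dir nu v i) < 0.
Hypothesis out : forall i, 0 < dot (nu i.+1) (dir nu v i).

Lemma X_good z t : X_ P w (z + t *: v, v) ->
  t = hit nu c v 0 z /\ good P nu c v z.
Proof.
move=> [_ [u [u0 ret nsk uw]]].
have u02 : (u 0%N).2 = v by rewrite u0.
have uw' i : w i (u i).1 by case: (uw i).
have [|t0 landE] := orbit_land u02 ret nsk uw' inc (z := z) (t := t).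
  by rewrite u0.
split=> // i; rewrite -landE; split=> //.
by case: (word_on_facet (uw' i)).
Qed.

Lemma good_X z : good P nu c v z -> X_ P w (z + hit nu c v 0 z *: v, v).
Proof.
move=> gz.
pose u i := (land nu c v i z, dir nu v i).
have hlt i : hit nu c v i z < hit nu c v i.+1 z.
  by apply: (hit_lt hP sup inc out) => //; case: (gz i).
have fl i t : hit nu c v i z < t < hit nu c v i.+1 z ->
    interior P (fold nu c i (z + t *: v)).
  by apply: (flight_interior hP sup v1 inc) => //; [case: (gz i)|case: (gz i)|case: (gz i.+1)].
split.
  split=> /=.
  - by apply: (support_bdry hP (sup 0%N)); [case: (gz 0%N) | exact: (dot_land c inc 0)].
  - by rewrite enorm1.
  - near=> s; have := fl 0%N (hit nu c v 0 z + s).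
    rewrite /= scalerDl addrA; apply; apply/andP; split.
      by rewrite ltrDl; near: s; apply: nbhs_right_gt.
    by rewrite -ltrBrDl; near: s; apply: nbhs_right_lt; rewrite subr_gt0.
exists u; split=> //.
- move=> i; exists (hit nu c v i.+1 z - hit nu c v i z); first by rewrite subr_gt0.
  split=> /=.
  + exact: land_step.
  + move=> s /andP[s0 s1]; rewrite /land fold_line -addrA -scalerDl.
    rewrite -fold_line; apply: fl; rewrite ltrDl s0 /=.
    by rewrite -ltrBrDl.
  + exists (nu i.+1), (w i.+1); have [fi _ wE] := nuc i.+1; split=> //.
    rewrite wE; split; first by case: (gz i.+1).
    exact: (dot_land c inc i.+1).
- by move=> i; case: (gz i).
- move=> i; have [fi _ wE] := nuc i; split; first by exists (nu i).
  rewrite wE; split; first by case: (gz i).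
  exact: (dot_land c inc i).
Unshelve. all: by end_near.
Qed.

End Itinerary.

(** * The trajectories of a tube are unfolded lines *)

Section Trajectory.
Context {R : realType} {n : nat} (P : set 'rV[R]_n).
Hypothesis hP : convex_polyhedron P.
Variables (nu : nat -> 'rV[R]_n) (c : nat -> R) (v : 'rV[R]_n).
Hypothesis sup : forall i, supporting P (nu i) (c i).
Hypothesis v1 : dot v v = 1.
Hypothesis inc : forall i, dot (nu i) (dir nu v i) < 0.
Hypothesis out : forall i, 0 < dot (nu i.+1) (dir nu v i).
Variable g : R -> 'rV[R]_n * bool.
Hypothesis g0 : forall t : R, double0 P (g t).
Hypothesis giso : forall t0 : R, exists2 r : R, 0 < r & forall s t : R,
  `|s - t0| < r -> `|t - t0| < r -> ddist P (g s) (g t) = `|s - t|.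
Variables (z : 'rV[R]_n) (b : bool).
Hypothesis gz : good P nu c v z.

Notation hit i := (hit nu c v i z).
Notation land i := (land nu c v i z).
Notation fold := (fold nu c).

Hypothesis gstart : forall s, 0 < s ->
  (forall r, 0 < r <= s -> interior P (z + (hit 0 + r) *: v)) ->
  g (hit 0 + s) = (z + (hit 0 + s) *: v, b).

Let hit_incr i : hit i < hit i.+1.
Proof. by apply: (hit_lt hP sup inc out); case: (gz i). Qed.

Let flight i t : hit i < t < hit i.+1 -> interior P (fold i (z + t *: v)).
Proof.
by apply: (flight_interior hP sup v1 inc); [case: (gz i)|case: (gz i)|case: (gz i.+1)].
Qed.

Let land_bdry i : bdry P (land i).
Proof.
by apply: (support_bdry hP (sup i)); [case: (gz i) | exact: (dot_land c inc i)].
Qed.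

Let bP : bdry P !=set0. Proof. by exists (land 0). Qed.

(** By induction on [i]: a crossing applies the reflection by which [fold i.+1]
    differs from [fold i], and changes copies. *)
Lemma trajectory_flight i t : hit i < t < hit i.+1 ->
  g t = (fold i (z + t *: v), b (+) odd i).
Proof.
elim: i t => [|i IH] t ht.
  rewrite addbF; have -> : t = hit 0 + (t - hit 0) by rewrite addrC subrK.
  case/andP: ht => t1 t2; apply: gstart; first by rewrite subr_gt0.
  move=> r /andP[r0 r1]; apply: (@flight 0%N); apply/andP; split; lra.
pose r := hit i.+1 - hit i.
have r0 : 0 < r by rewrite subr_gt0.
have foldE j k s : fold k (z + s *: v) = fold k (z + hit j *: v) + (s - hit j) *: dir nu v k.
  by rewrite !fold_line; apply/rowP => l; rewrite !mxE; ring.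
have before s : hit i.+1 - r < s < hit i.+1 ->
    g s = (land i.+1 + (s - hit i.+1) *: dir nu v i, b (+) odd i).
  move=> hs; rewrite (land_prev sup inc) -foldE; apply: IH.
  by move: hs; rewrite /r opprB addrC subrK.
have [r' r'0 after] := geodesic_cross hP g0 giso bP r0 (sup i.+1)
  (dot_land c inc i.+1 z) (dot_dir sup v1 i) (out i) before.
rewrite (foldE i.+1) [odd _]/= addbN.
apply: (@geodesic_flight _ _ _ hP g giso bP (hit i.+1) (hit i.+2 - hit i.+1)
  r' (land i.+1) (dir nu v i.+1)) => //.
- exact: (dot_dir sup v1 i.+1).
- move=> s /andP[s1 s2]; have e : hit i.+1 + s - hit i.+1 = s by ring.
  have := @flight i.+1 (hit i.+1 + s); rewrite (foldE i.+1) e; apply.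
  by apply/andP; split; lra.
- by case/andP: ht => -> ht; rewrite /= addrC subrK.
Qed.

Lemma trajectory_landing i : (g (hit i.+1)).1 = land i.+1.
Proof.
have r0 : 0 < hit i.+1 - hit i by rewrite subr_gt0.
apply: (geodesic_endpoint giso bP r0 (v := dir nu v i) (b := b (+) odd i)).
  move=> s; rewrite opprB addrC subrK => hs.
  rewrite (land_prev sup inc) (trajectory_flight hs) !fold_line; congr (_, _).
  by apply/rowP => l; rewrite !mxE; ring.
exact: (dot_dir sup v1 i).
Qed.

Lemma trajectory_cover t : hit 0 < t -> exists i,
  hit i <= t <= hit i.+1 /\ (g t).1 = fold i (z + t *: v).
Proof.
move=> t0.
have ex : exists i, t <= hit i.+1.
  have [|||i hi] := @geodesic_nonzeno _ _ _ hP g g0 giso bP (fun i => hit i.+1) _ _ _ t.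
  - by move=> i; apply: hit_incr.
  - by move=> i; rewrite trajectory_landing.
  - by move=> i s hs; rewrite (trajectory_flight hs); apply: flight.
  - by exists i; apply: ltW.
case: (ex_minnP ex) => i ti imin; exists i.
have it : hit i < t.
  case: i ti imin => [//|i] ti imin; rewrite ltNge; apply/negP => h.
  by have := imin i h; rewrite ltnn.
rewrite (ltW it) ti; split=> //; move: ti; rewrite le_eqVlt => /orP[/eqP e|ti].
  by rewrite {1}e trajectory_landing (land_prev sup inc) -e.
by rewrite (@trajectory_flight i) // it.
Qed.

Lemma trajectory_closest t s i : hit 0 < t -> P s ->
  edist (g t).1 s <= edist (fold i (z + t *: v)) s.
Proof.
move=> /trajectory_cover[j [hj ->]] Ps.
by apply: (billiard_closest sup inc out) => // k; apply: ltW.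
Qed.

End Trajectory.

(** * Recurrence *)

Section Recurrence.
Context {R : realType} {m : nat}.
Variables (rho rho' : 'rV[R]_m -> 'rV[R]_m).
Hypothesis iso : forall x y, edist (rho x) (rho y) = edist x y.
Hypothesis rhoK : forall x, rho (rho' x) = x.
Hypothesis orbit_bounded : forall x k, enorm (iter k rho x) <= enorm x.
Implicit Types (x y : 'rV[R]_m).

Lemma enorm_bounded (A : set 'rV[R]_m) (B : R) :
  (forall x, A x -> enorm x <= B) -> bounded_set A.
Proof.
move=> h; exists B; split; first exact: num_real.
move=> x Bx y /h hy; apply: le_trans (norm_le_enorm y) _.
by apply: le_trans hy _; apply: ltW.
Qed.

Lemma edist_iter k x y : edist (iter k rho x) (iter k rho y) = edist x y.
Proof. by elim: k => [|k IH] //=; rewrite iso. Qed.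

Lemma iterK k x : iter k rho (iter k rho' x) = x.
Proof. by elim: k x => [|k IH] x //; rewrite iterSr /= rhoK IH. Qed.

(** The orbit accumulates somewhere, so that two of its points, at far apart
    indices, are close to each other; applying the isometry backwards makes the
    earlier one the starting point. *)
Lemma recurrence x N (e : R) : 0 < e ->
  exists2 k, (N <= k)%N & edist (iter k rho x) x < e.
Proof.
move=> e0; pose A := closure [set y | exists k, y = iter k rho x].
have cA : compact A.
  apply: bounded_closed_compact; last exact: closed_closure.
  apply: (@enorm_bounded _ (enorm x + 1)) => y /closureP /(_ 1 ltr01) [_ [k ->]].
  rewrite -(subrK (iter k rho x) y) /edist => h.
  move: h; rewrite addrK => h; apply: le_trans (enormD _ _) _.
  by rewrite addrC lerD // ltW.
have [p [_ clp]] : A `&` cluster (iter k rho x @[k --> \oo]) !=set0.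
  by apply: cA; exists 0%N => // k _; apply: subset_closure; exists k.
have visit M : exists2 k, (M <= k)%N & edist p (iter k rho x) < e / 2.
  have [||_ [[k /= Mk <-] hk]] := clp [set iter k rho x | k in [set k | (M <= k)%N]]
      [set y | edist p y < e / 2].
  - by exists M => // k /= Mk; exists k.
  - by apply/nbhs_edistP; exists (e / 2); rewrite ?divr_gt0.
  by exists k.
have [i _ hi] := visit 0%N; have [j ij hj] := visit (i + N)%N.
have le_ij : (i <= j)%N by apply: leq_trans ij; apply: leq_addr.
exists (j - i)%N; first by rewrite leq_subRL.
rewrite -(edist_iter i) -iterD subnKC //.
by have := edist_triangle p (iter j rho x) (iter i rho x); rewrite (edistC _ p); lra.
Qed.

(** The distance to the complement of an invariant set does not decrease along an
    orbit. As the orbit returns close to its origin, it cannot increase either. *)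
Lemma ball_sub_pullback (Om : set 'rV[R]_m) k x (r r' : R) :
  (forall y, Om y -> Om (rho y)) -> r' < r ->
  (forall y, edist (iter k rho x) y < r -> Om y) ->
  forall y, edist x y < r' -> Om y.
Proof.
move=> st rr h y xy.
have [N kN hN] := @recurrence x k (r - r') ltac:(by rewrite subr_gt0).
have stk l u : Om u -> Om (iter l rho u) by move=> Omu; elim: l => //= l; apply: st.
rewrite -(iterK (N - k) y); apply/stk/h.
rewrite -(edist_iter (N - k)) iterK -iterD subnK //.
by have := edist_triangle x (iter N rho x) y; lra.
Qed.

End Recurrence.

Section TubeMetric.
Context {R : realType} {m : nat}.

Lemma tdist_lt (p q : 'rV[R]_m * R) (d : R) : tdist p q < d ->
  edist p.1 q.1 < d /\ `|p.2 - q.2| < d.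
Proof.
rewrite /tdist => h; split; apply: le_lt_trans h.
  rewrite -{1}(ger0_norm (edist_ge0 p.1 q.1)) -sqrtr_sqr ler_wsqrtr //.
  by rewrite lerDl sqr_ge0.
by rewrite -sqrtr_sqr ler_wsqrtr // lerDr sqr_ge0.
Qed.

Lemma tdist_fiber (p : 'rV[R]_m) (s t : R) : tdist (p, s) (p, t) = `|s - t|.
Proof. by rewrite /tdist /= edistxx expr0n /= add0r sqrtr_sqr. Qed.

End TubeMetric.

Lemma near_skeleton_U {R : realType} {n : nat} (P : set 'rV[R]_n) (eps : R) A s :
  convex_polyhedron P -> Defs.double P A -> skeleton P s -> edist A.1 s < eps ->
  U_ P eps A.
Proof.
move=> hP dA sk As; split=> //; exists (s, true); first by split.
apply: le_lt_trans As; have := @ddist_le _ _ P A (s, true) s (skeleton_bdry hP sk).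
by rewrite edistxx addr0.
Qed.

(** * The tube and its boundary *)

Section Tube.
Context {R : realType} {n : nat} (P : set 'rV[R]_n).
Hypothesis hP : convex_polyhedron P.
Variables (Omega : set 'rV[R]_n.-1) (F : 'rV[R]_n.-1 * R -> 'rV[R]_n * bool).
Hypothesis hF : immersed_tube P Omega F.
Variables (L : R) (Rot : 'M[R]_n.-1).
Hypothesis L0 : 0 < L.
Hypothesis RotT : Rot *m Rot^T = 1%:M.
Hypothesis period : forall x t, Omega x ->
  Omega (x *m Rot) /\ F (x, t + L) = F (x *m Rot, t).
Variables (w : nat -> set 'rV[R]_n) (a v : 'rV[R]_n) (E : 'M[R]_(n.-1, n)).
Variable b : bool.

Let base (x : 'rV[R]_n.-1) : 'rV[R]_n := a + x *m E.
Let section := [set x | exists t : R, X_ P w (base x + t *: v, v)].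

Hypothesis EET : E *m E^T = 1%:M.
Hypothesis EvT : E *m v^T = 0.
Hypothesis v1 : dot v v = 1.
Hypothesis int_section : interior section `<=` Omega.
Hypothesis sub_section : Omega `<=` section.
Hypothesis F_start : forall x t, Omega x -> X_ P w (base x + t *: v, v) ->
  forall s : R, 0 < s ->
  (forall r, 0 < r <= s -> interior P (base x + (t + r) *: v)) ->
  F (x, t + s) = (base x + (t + s) *: v, b).
Variables (nu : nat -> 'rV[R]_n) (c : nat -> R).
Hypothesis nuc : word_normals P w nu c.
Hypothesis inc : forall i, dot (nu i) (dir nu v i) < 0.
Hypothesis out : forall i, 0 < dot (nu i.+1) (dir nu v i).

Let sup i : supporting P (nu i) (c i). Proof. by case: (nuc i). Qed.

Local Notation rho := (fun x : 'rV[R]_n.-1 => x *m Rot).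
Local Notation rho' := (fun x : 'rV[R]_n.-1 => x *m Rot^T).
Local Notation T0 x := (hit nu c v 0 (base x)).

Let dot_rho x y : dot (x *m Rot) (y *m Rot) = dot x y.
Proof. by rewrite /dot trmx_mul -mulmxA (mulmxA Rot) RotT mul1mx. Qed.

Let rho_iso x y : edist (rho x) (rho y) = edist x y.
Proof. by rewrite /edist -mulmxBl /enorm dot_rho. Qed.

Let RotTl : Rot^T *m Rot = 1%:M. Proof. exact: mulmx1C. Qed.

Let rhoK x : rho (rho' x) = x.
Proof. by rewrite /= -mulmxA RotTl mulmx1. Qed.

Let rho_orbit x k : enorm (iter k rho x) <= enorm x.
Proof. by elim: k => //= k IH; rewrite {1}/enorm dot_rho. Qed.

Let rho_stable x : Omega x -> Omega (rho x).
Proof. by move=> /(period 0)[]. Qed.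

Let rho_stable_iter k x : Omega x -> Omega (iter k rho x).
Proof. by move=> Ox; elim: k => //= k; apply: rho_stable. Qed.

Let F_iter k x t : Omega x -> F (x, t + k%:R * L) = F (iter k rho x, t).
Proof.
move=> Ox; elim: k t => [|k IH] t; first by rewrite mul0r addr0.
rewrite mulrSr mulrDl mul1r addrA addrAC IH iterS.
by have [_] := period t (rho_stable_iter k Ox).
Qed.

Lemma base_dist x y : edist (base x) (base y) = edist x y.
Proof.
rewrite edist_addl /edist -mulmxBl /enorm /dot.
by rewrite trmx_mul mulmxA -(mulmxA _ E) EET mulmx1.
Qed.

(** A point of the cross-section may be displaced as long as its landing points,
    which are affine functions of it, stay in their facets and off the skeleton;
    this is the form in which maximality is used. *)
Lemma section_good x : section x <-> good P nu c v (base x).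
Proof.
split=> [[t /(X_good hP nuc inc)[]] //|gx].
by exists (T0 x); apply: good_X.
Qed.

Let Omega_good x : Omega x -> good P nu c v (base x).
Proof. by move=> /sub_section/section_good. Qed.

Section Fiber.
Variable p : 'rV[R]_n.-1.
Hypothesis Op : Omega p.

Let g t := F (p, t).

Let g0 (t : R) : double0 P (g t).
Proof. by have [] := hF (x := (p, t)) (conj Op I). Qed.

Let giso (t0 : R) : exists2 r : R, 0 < r & forall s t : R,
  `|s - t0| < r -> `|t - t0| < r -> ddist P (g s) (g t) = `|s - t|.
Proof.
have [_ [r r0 iso]] := hF (x := (p, t0)) (conj Op I).
exists r => // s t hs ht; rewrite -(tdist_fiber p); apply: iso => //.
  by rewrite tdist_fiber distrC.
by rewrite tdist_fiber distrC.
Qed.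

Let gstart s : 0 < s ->
  (forall r, 0 < r <= s -> interior P (base p + (T0 p + r) *: v)) ->
  g (T0 p + s) = (base p + (T0 p + s) *: v, b).
Proof. by apply: F_start => //; apply/(good_X hP nuc v1 inc out)/Omega_good. Qed.

Lemma fiber_cover t : T0 p < t -> exists i, (F (p, t)).1 = fold nu c i (base p + t *: v).
Proof.
move=> ht; have [i [_ hi]] :=
  trajectory_cover hP sup v1 inc out g0 giso (Omega_good Op) gstart ht.
by exists i.
Qed.

Lemma fiber_closest t s i : T0 p < t -> P s ->
  edist (F (p, t)).1 s <= edist (fold nu c i (base p + t *: v)) s.
Proof.
exact: (trajectory_closest hP sup v1 inc out g0 giso (Omega_good Op) gstart).
Qed.

End Fiber.

Lemma Omega_bounded : exists B : R, forall x, Omega x -> enorm x <= B /\ `|T0 x| <= B.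
Proof.
have [_ [M hM] _] := hP.
exists (M + enorm a + (M + `|dot a v|)) => x /Omega_good gx.
have [/hM Px _] := gx 0%N; rewrite /land /= in Px.
have xv : dot (x *m E) v = 0 by rewrite /dot -mulmxA EvT mulmx0 mxE.
have va : `|dot (base x + T0 x *: v) v| <= enorm (base x + T0 x *: v).
  have := dot_le_enorm (base x + T0 x *: v) v.
  have := dot_le_enorm (- (base x + T0 x *: v)) v.
  by rewrite dotNl enormN (enorm1 v1) mulr1 ler_norml lerNl => -> ->.
have hT : `|T0 x| <= M + `|dot a v|.
  have TE : T0 x = dot (base x + T0 x *: v) v - dot a v.
    by rewrite /base !dotlin xv v1; ring.
  rewrite [X in `|X|]TE; apply: le_trans (ler_normB _ _) _.
  by rewrite lerD2r; apply: le_trans va Px.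
split; last first.
  apply: le_trans hT _; rewrite lerDr addr_ge0 ?enorm_ge0 //.
  by apply: le_trans Px; apply: enorm_ge0.
have -> : enorm x = enorm (x *m E).
  rewrite /enorm /dot trmx_mul mulmxA -(mulmxA _ E) EET mulmx1 //.
have -> : x *m E = base x + T0 x *: v - a - T0 x *: v.
  by rewrite /base; apply/rowP => k; rewrite !mxE; ring.
apply: le_trans (enormD _ _) _; rewrite enormN enormZ (enorm1 v1) mulr1 lerD //.
by apply: le_trans (enormD _ _) _; rewrite enormN lerD2r.
Qed.

(** This is where maximality acts. By recurrence under the rotation, a trajectory
    that avoids the skeleton after the time [M] reappears, near the same boundary
    point and shifted by many periods, as one that always avoids it. If this held
    for the trajectories near [q], the word [w] would occur in a neighbourhood of
    [q] by [good_ball], and [q] would be interior. *)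
Lemma bdry_near_skeleton q (e M : R) : bdry Omega q -> 0 < e ->
  exists p t s, [/\ Omega p, M <= t, skeleton P s, edist p q < e &
    edist (F (p, t)).1 s < e].
Proof.
move=> [clq nintq] e0; apply: contrapT => none.
have far p t s : Omega p -> M <= t -> skeleton P s -> edist p q < e ->
    e <= edist (F (p, t)).1 s.
  move=> Op Mt sk pq; rewrite leNgt; apply/negP => h.
  by apply: none; exists p, t, s.
pose K := (- dot (nu 0%N) v)^-1.
have K0 : 0 < K by rewrite invr_gt0 oppr_gt0; apply: (inc 0%N).
pose d := e / (2 * (1 + K)).
have K1 : 0 < 2 * (1 + K) by rewrite mulr_gt0 // addr_gt0.
have d0 : 0 < d by rewrite divr_gt0.
have dE : d * (2 * (1 + K)) = e by rewrite divfK // gt_eqF.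
have de : d < e by nra.
have [B hB] := Omega_bounded.
(* So many periods make up for trajectories starting as early as -B. *)
have [N0 hN0] : exists N, B + M < N%:R * L.
  exists (Num.truncn ((B + M) / L)).+1; rewrite -ltr_pdivrMr //.
  exact: truncnS_gt.
have [N N0N hN] := recurrence rho_iso rho_orbit q N0 (e := d / 2) ltac:(by rewrite divr_gt0).
have [p0 Op0 qp0] := (closureP _ _).1 clq (d / 2) ltac:(by rewrite divr_gt0).
pose p := iter N rho p0.
have Op : Omega p by apply: rho_stable_iter.
have pq : edist p q < d.
  have := edist_triangle (iter N rho q) p q.
  by rewrite (edist_iter rho_iso) (edistC p0); lra.
have gp x : edist p x <= d -> section x.
  move=> px; apply/section_good.
  apply: (good_ball hP sup v1 inc out (z0 := base p) (e := e) (d := d)) => //.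
  - exact: Omega_good.
  - move=> i t s Tt sk.
    have Ps : P s by case/(polyhedron_bdryP hP): (skeleton_bdry hP sk).
    apply: le_trans (fiber_closest Op i Tt Ps); rewrite -F_iter //.
    apply: far => //; last by apply: lt_trans de; rewrite edistC; apply: lt_trans qp0 _; lra.
    have := (hB _ Op).2; rewrite ler_norml => /andP[hT _].
    have : N0%:R * L <= N%:R * L by rewrite ler_pM2r // ler_nat.
    lra.
  - exact: ltW.
  - by rewrite -/K; nra.
  - by rewrite base_dist.
apply: nintq; apply/interiorP; exists (d - edist p q); first by rewrite subr_gt0.
move=> x qx; apply: int_section.
apply: (@interior_edist _ _ section p d) => [y py|]; first by apply/gp/ltW.
by have := edist_triangle q p x; lra.
Qed.

(** The trajectory found near a boundary point also serves the boundary points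
    nearby, so that by compactness finitely many trajectories suffice. *)
Lemma bdry_near_skeleton_uniform (e M : R) : 0 < e -> exists l : R,
  forall q, bdry Omega q -> exists p t s,
    [/\ Omega p, M <= t <= l, skeleton P s, edist p q < 2 * e &
      edist (F (p, t)).1 s < e].
Proof.
move=> e0; have [B hB] := Omega_bounded.
have : compact (bdry Omega).
  apply: bounded_closed_compact.
    apply: (@enorm_bounded _ _ _ (B + 1)) => q [/closureP/(_ 1 ltr01)[y Oy qy] _].
    have := enormD (q - y) y; rewrite subrK -/(edist q y).
    by have := (hB _ Oy).1; lra.
  apply: closedI; first exact: closed_closure.
  exact/open_closedC/open_interior.
move=> /compact_near_coveringP cov.
pose near_at l q := exists p t s, [/\ Omega p, M <= t <= l, skeleton P s,
  edist p q < 2 * e & edist (F (p, t)).1 s < e].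
have /filter_ex[l hl] : \forall l \near pinfty_nbhs R, bdry Omega `<=` near_at l.
  apply: (cov R (pinfty_nbhs R) near_at) => q /bdry_near_skeleton/(_ e0).
  move=> /(_ M)[p [t [s [Op Mt sk pq ps]]]].
  exists ([set q' | edist q q' < e], [set l | t <= l]) => /=; first split.
  - by apply/nbhs_edistP; exists e.
  - exact: (nbhs_pinfty_ge (num_real t)).
  case=> q' l [/= qq' tl]; exists p, t, s; rewrite Mt tl; split=> //.
  by have := edist_triangle q p q'; lra.
by exists l.
Qed.

(** The point [p0] is replaced by its image [pk] under a power of the rotation,
    positive or negative according to the sign of [z0], to bring [z0] into one
    period. A boundary point [q] near [pk] and a trajectory [p1] near [q] that
    approaches the skeleton at a time [t] then show that all the trajectories near
    [pk] are [eps]-close to the skeleton around the time [t]. *)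
Lemma tube_near_skeleton (eps : R) : 0 < eps ->
  exists delta l eta : R,
    [/\ 0 < delta, 0 < l, 0 < eta < eps / 2 &
      forall (p0 : 'rV[R]_n.-1) (z0 : R),
        (Omega_r Omega (eps / 2 - eta) `\` Omega_r Omega (eps / 2 + eta)) p0 ->
        exists2 z : R, `|z - z0| <= l &
          [set q | tdist (p0, z) q < delta] `<=`
            (Omega `*` setT) `&` F @^-1` (U_ P eps)].
Proof.
move=> eps0.
(* The radius [eps / 2 + eta] is enlarged by at most six further multiples of
   [eta] in all, which must leave it below [eps]. *)
pose eta := eps / 20.
have eta0 : 0 < eta by rewrite divr_gt0.
have etaE : eta * 20 = eps by rewrite divfK.
have [B hB] := Omega_bounded.
have [l0 hl0] := bdry_near_skeleton_uniform (B + 1 + eta) eta0.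
pose r1 := eps / 2 - eta; pose r2 := eps / 2 + eta.
have near_hit pk : Omega pk ->
    (exists2 y, ~ Omega y & edist pk y < r2 + eta) ->
    exists2 t : R, `|t| <= `|B + 1 + eta| + `|l0| &
      forall p t', Omega p -> edist pk p < eta -> `|t - t'| < eta ->
        U_ P eps (F (p, t')).
  move=> Opk [y nOy pky]; have [s s01 bq] := segment_bdry Opk nOy.
  set q := pk + _ in bq; have pkq : edist pk q < r2 + eta.
    apply: le_lt_trans pky; case/andP: s01 => s0 s1.
    rewrite edist_shift ger0_norm // -/(edist y pk) edistC ler_piMl //.
    exact: edist_ge0.
  have [p1 [t [x [Op1 /andP[t1 t2] sk p1q px]]]] := hl0 _ bq.
  exists t.
    have h1 := ler_norm l0; have h2 := ler_norm (- (B + 1 + eta)).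
    have h3 := normr_ge0 l0; have h4 := normr_ge0 (B + 1 + eta).
    by rewrite normrN in h2; rewrite ler_norml; apply/andP; split; lra.
  move=> p t' Op pkp tt'.
  have T0le u : Omega u -> T0 u <= B.
    by move=> /hB[_]; apply: le_trans; apply: ler_norm.
  have tB : T0 p1 < t by have := T0le _ Op1; lra.
  have tB' : T0 p < t'.
    by have := T0le _ Op; move: tt'; rewrite ltr_norml => /andP[_]; lra.
  have Px : P x by case/(polyhedron_bdryP hP): (skeleton_bdry hP sk).
  have [j hj] := fiber_cover Op1 tB.
  apply: (near_skeleton_U (s := x)) => //.
    by have [[]] := hF (x := (p, t')) (conj Op I).
  apply: le_lt_trans (fiber_closest Op j tB' Px) _.
  move: px; rewrite hj.
  have := edist_triangle (fold nu c j (base p1 + t *: v))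
    (fold nu c j (base p + t' *: v)) x.
  have := edist_triangle (base p + t *: v) (base p1 + t *: v) (base p + t' *: v).
  rewrite !(edist_fold sup) edist_addr edist_line (enorm1 v1) mulr1 base_dist.
  have := edist_triangle q p1 p; have := edist_triangle pk q p.
  rewrite (edistC q pk) (edistC (base p1 + _)) /r2 in pkq *.
  lra.
exists eta, (`|B + 1 + eta| + `|l0| + L), eta; split=> //.
- by rewrite ltr_wpDl // addr_ge0.
- by rewrite eta0; lra.
move=> p0 z0 [[Op0 far0] near0].
have [q0 bq0 pq0] : exists2 q, bdry Omega q & edist p0 q < r2.
  by apply: contrapT => h; apply: near0.
have inner y : edist p0 y < r1 -> Omega y.
  move=> p0y; apply: contrapT => nOy; have [s s01 bq] := segment_bdry Op0 nOy.
  apply: far0; exists (p0 + s *: (y - p0)) => //; apply: le_lt_trans p0y.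
  case/andP: s01 => s0 s1; rewrite edist_shift ger0_norm // -/(edist y p0) edistC.
  by rewrite ler_piMl // edist_ge0.
have [y0 nOy0 p0y0] : exists2 y, ~ Omega y & edist p0 y < r2.
  apply: contrapT => h; case: bq0 => _; apply; apply/interiorP.
  exists (r2 - edist p0 q0); first by rewrite subr_gt0.
  move=> y qy; apply: contrapT => nOy; apply: h; exists y => //.
  by have := edist_triangle q0 p0 y; lra.
have rho'_iso x y : edist (rho' x) (rho' y) = edist x y.
  by rewrite -rho_iso !rhoK.
have edist_iter' := edist_iter rho'_iso.
have rhoK' k x : iter k rho (iter k rho' x) = x by apply: iterK rhoK _ _.
have rho'K k x : iter k rho' (iter k rho x) = x.
  apply: (iterK (rho := rho') (rho' := rho)) => u.
  by rewrite -mulmxA RotT mulmx1.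
have [k hk] : exists k : nat, `|z0 - k%:R * L| <= L \/ `|z0 + k%:R * L| <= L.
  have [z0p|z0n] := leP 0 z0.
    exists (Num.truncn (z0 / L)); left.
    have := truncn_itv (divr_ge0 z0p (ltW L0)); rewrite ler_pdivlMr // ltr_pdivrMr //.
    by rewrite -natr1 mulrDl mul1r ler_norml => /andP[h1 h2]; apply/andP; split; lra.
  exists (Num.truncn (- z0 / L)); right.
  have z0n' : 0 <= - z0 by rewrite oppr_ge0 ltW.
  have := truncn_itv (divr_ge0 z0n' (ltW L0)); rewrite ler_pdivlMr // ltr_pdivrMr //.
  by rewrite -natr1 mulrDl mul1r ler_norml => /andP[h1 h2]; apply/andP; split; lra.
case: hk => hk.
  (* Forward images: their balls in Omega are no larger than that of p0. *)
  have [|t tl hU] := near_hit (iter k rho p0) (rho_stable_iter k Op0).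
    apply: contrapT => h.
    have h' y : edist (iter k rho p0) y < r2 + eta -> Omega y.
      by move=> hy; apply: contrapT => nOy; apply: h; exists y.
    apply: nOy0; apply: (ball_sub_pullback rho_iso rhoK rho_orbit rho_stable _ h' p0y0).
    by rewrite ltrDl.
  exists (t + k%:R * L).
    have := ler_normD t (k%:R * L - z0).
    by rewrite distrC addrA; lra.
  move=> [p z'] /tdist_lt /= [p0p zz'].
  have Op : Omega p by apply: inner; apply: lt_trans p0p _; rewrite /r1; lra.
  split=> //=; rewrite -(subrK (k%:R * L) z') F_iter //.
  apply: hU; first exact: rho_stable_iter.
    by rewrite (edist_iter rho_iso).
  by rewrite opprB addrA.
(* Backward images: their balls in Omega are almost as large as that of p0, and
   so they belong to Omega. *)
have inner' y : edist (iter k rho' p0) y < r1 - eta -> Omega y.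
  apply: (ball_sub_pullback rho_iso rhoK rho_orbit rho_stable (k := k) (r := r1)).
    by rewrite gtrBl.
  by move=> u; rewrite rhoK'; apply: inner.
have [||t tl hU] := near_hit (iter k rho' p0).
- by apply: inner'; rewrite edistxx /r1; lra.
- exists (iter k rho' y0); last by rewrite edist_iter' ltr_wpDr // ltW.
  by move=> /(rho_stable_iter k); rewrite rhoK'.
exists (t - k%:R * L).
  have := ler_normB t (z0 + k%:R * L).
  by rewrite opprD addrA addrAC; lra.
move=> [p z'] /tdist_lt /= [p0p zz'].
have Op : Omega p by apply: inner; apply: lt_trans p0p _; rewrite /r1; lra.
split=> //=.
have Op' : Omega (iter k rho' p).
  by apply: inner'; rewrite edist_iter'; apply: lt_trans p0p _; rewrite /r1; lra.
rewrite -(rhoK' k p) -F_iter //; apply: hU => //; first by rewrite edist_iter'.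
by rewrite opprD addrA addrAC.
Qed.

End Tube.

Theorem lemma3p14 (R : realType) (n : nat) (hn : (2 <= n)%N)
    (P : set 'rV[R]_n) (hP : convex_polyhedron P)
    (eps : R) (heps : 0 < eps)
    (Omega : set 'rV[R]_n.-1) (F : 'rV[R]_n.-1 * R -> 'rV[R]_n * bool)
    (hF : immersed_tube P Omega F) (hper : periodic_tube Omega F)
    (hmax : maximal_tube P Omega F) :
  exists delta l eta : R,
    [/\ 0 < delta, 0 < l, 0 < eta < eps / 2 &
      forall (p0 : 'rV[R]_n.-1) (z0 : R),
        (Omega_r Omega (eps / 2 - eta) `\` Omega_r Omega (eps / 2 + eta)) p0 ->
        exists2 z : R, `|z - z0| <= l &
          [set q | tdist (p0, z) q < delta] `<=`
            (Omega `*` setT) `&` F @^-1` (U_ P eps)].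
Proof.
have [L L0 [Rot [RotT _] period]] := hper.
have [w [a [v [E [b [[[[y y2] Xy] Xv] [EET EvT v1] [intC subC] start]]]]]] := hmax.
have y2v : y2 = v := Xv _ Xy; rewrite y2v in Xy.
have [nu [c nuc]] : exists nu c, word_normals P w nu c.
  by apply: word_normals_exist => i; case: Xy => _ [u [_ _ _ /(_ i)[]]].
have [inc out] := X_signs hP nuc Xy.
exact: (tube_near_skeleton hP hF L0 RotT period EET EvT v1 intC subC start nuc inc out).
Qed.
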